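(* Let $d_1\ge\dots\ge d_N$ be positive integers. Consider the gm-spaces $\mathbb X_i=(\mathbb R^{d_i},\langle\cdot,\cdot\rangle_{d_i},\xi_i)$, $i=1,\dots,N$, where $\langle\cdot,\cdot\rangle_{d_i}$ is the standard scalar product on $\mathbb R^{d_i}$ and $\xi_i=\mathcal N(0,\Sigma_i)$ are centered non-degenerate Gaussian distributions on $\mathbb R^{d_i}$. Let the covariance matrices be diagonalized as $\Sigma_i=P_iD_iP_i^{\mathrm T}$ ($P_i$ orthogonal, $D_i$ diagonal) with the eigenvalues sorted in decreasing order. For fixed $\tilde I_i\in\mathcal D_{d_i}$, let $T_i:\mathbb R^{d_1}\to\mathbb R^{d_i}$ be defined by $$T_i(x)=P_iA_iP_1^{\mathrm T}x,\qquad A_i:=\Bigl(\tilde I_i\,D_i^{1/2}\bigl(D_1^{(d_i)}\bigr)^{-1/2}\ \Big|\ 0_{d_i,d_1-d_i}\Bigr)\in\mathbb R^{d_i\times d_1}.$$ Then for all $\rho\in\Delta_{N-1}$, $$(T_1,\dots,T_N)_\#\xi_1\in\Pi_{\mathrm o}^\rho(\mathbb X_1,\dots,\mathbb X_N),$$ and the gm-space $$\mathbb Y:=(\mathbb R^{d_1},\langle\cdot,\cdot\rangle_{d_1},\hat\upsilon),\qquad \hat\upsilon:=\mathcal N\Bigl(0,\ \sum_{i=1}^N\rho_i\begin{pmatrix}D_i&0\\0&0\end{pmatrix}\Bigr),$$ where each block matrix is in $\mathbb R^{d_1\times d_1}$, is a GW barycenter, i.e. $\llbracket\mathbb Y\rrbracket$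 minimizes $\mathfrak W\mapsto\sum_{i=1}^N\rho_i\,\mathrm{GW}^2(\llbracket\mathbb X_i\rrbracket,\mathfrak W)$ over $\mathfrak W\in\mathfrak{GM}$.
   Context: A gauged measure space (gm-space) is a triple $\mathbb X=(X,g,\xi)$ where $X$ is a Polish space, $\xi$ is a Borel probability measure on $X$, and $g$ is a gauge, i.e. $g\in L^2_{\mathrm{sym}}(X\times X,\xi\otimes\xi)$ (symmetric, real-valued, square-integrable). For gm-spaces $\mathbb X=(X,g,\xi)$, $\mathbb Y=(Y,h,\upsilon)$, $\Pi(\mathbb X,\mathbb Y)$ is the set of Borel probability measures on $X\times Y$ with marginals $\xi,\upsilon$, and $\mathrm{GW}(\mathbb X,\mathbb Y):=\inf_{\pi\in\Pi(\mathbb X,\mathbb Y)}\bigl(\iint |g(x,x')-h(y,y')|^2\,d\pi(x,y)\,d\pi(x',y')\bigr)^{1/2}$. Spaces are homomorphic if $\mathrm{GW}(\mathbb X,\mathbb Y)=0$; $\llbracket\mathbb X\rrbracket$ denotes the equivalence class and $\mathfrak{GM}$ the set of all classes, which is a metric space under $\mathrm{GW}$. $\Delta_{N-1}:=\{\rho\in[0,1]^N:\sum_i\rho_i=1\}$. For gm-spaces $\mathbb X_i=(X_i,g_i,\xi_i)$, $\Pi(\mathbb X_1,\dots,\mathbb X_N)$ is the set of Borel probability measures on $X_1\times\cdots\times X_N$ with $i$-th marginal $\xi_i$, and $\Pi_{\mathrm o}^\rho(\mathbb X_1,\dots,\mathbb X_N)$ is the set of minimizers over $\Pi(\mathbb X_1,\dots,\mathbb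 X_N)$ of the multi-marginal GW functional $$\pi\mapsto\iint\tfrac12\sum_{i,j=1}^N\rho_i\rho_j\,|g_i(x_i,x_i')-g_j(x_j,x_j')|^2\,d\pi(x_1,\dots,x_N)\,d\pi(x_1',\dots,x_N').$$ $B^{(d)}$ denotes the upper left $d\times d$ submatrix of a matrix $B$; $\mathcal D_d:=\{\operatorname{diag}(s_1,\dots,s_d):s_k\in\{-1,1\}\}$; $0_{a,b}$ is the $a\times b$ zero matrix; $(A\,|\,B)$ is horizontal concatenation; $\#$ is the push-forward; Gaussian distributions $\mathcal N(0,\Sigma)$ are allowed to have singular covariance in the definition of $\hat\upsilon$. *)

(* Defs.v *)
From HB Require Import structures.
From mathcomp Require Import all_boot all_order all_algebra.
From mathcomp Require Import all_classical all_reals all_analysis.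

Set Implicit Arguments.
Unset Strict Implicit.
Unset Printing Implicit Defensive.
Import Order.TTheory GRing.Theory Num.Theory.
Import numFieldNormedType.Exports.
Local Open Scope classical_set_scope.
Local Open Scope ring_scope.

Notation borel T := (g_sigma_algebraType (@open T)).

HB.instance Definition _ (T U : ptopologicalType) := Pointed.on (T * U)%type.
HB.instance Definition _ (I : Type) (T : I -> ptopologicalType) :=
  isPointed.Build (prod_topology T) (fun i => point).

Definition metrizes (R : realType) (T : topologicalType) (d : T -> T -> R) :=
  [/\ forall x y, d x y = 0 <-> x = y,
      forall x y, d x y = d y x,
      forall x y z, d x z <= d x y + d y z
    & forall (x : T) (A : set T),
        nbhs x A <-> exists2 e : R, 0 < e & [set y | d x y < e] `<=` A].

Definition complete_dist (R : realType) (T : topologicalType)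
    (d : T -> T -> R) :=
  forall u : nat -> T,
    (forall e : R, 0 < e ->
       exists K : nat, forall m n, (K <= m)%N -> (K <= n)%N ->
         d (u m) (u n) < e) ->
    exists l : T, u @ \oo --> l.

Definition separable (T : topologicalType) :=
  exists2 S : set T, countable S & dense S.

Definition polish (R : realType) (T : topologicalType) :=
  separable T /\
  exists d : T -> T -> R, metrizes d /\ complete_dist d.

Record gm_triple (R : realType) := GMTriple {
  gm_carrier : ptopologicalType;
  gm_gauge : gm_carrier -> gm_carrier -> R;
  gm_measure : probability (borel gm_carrier) R }.

(* The gauge is a representative of an element of L^2_sym, so its symmetry is
   only required almost everywhere. *)
Definition gm_space (R : realType) (X : gm_triple R) :=
  let mu : {measure set (borel (gm_carrier X) * borel (gm_carrier X)) -> \bar R}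
    := (gm_measure X \x gm_measure X)%E in
  [/\ polish R (gm_carrier X),
      (fun z : borel (gm_carrier X) * borel (gm_carrier X) =>
         gm_gauge z.1 z.2) \in Lfun mu 2%:E
    & {ae mu, forall z, gm_gauge z.1 z.2 = gm_gauge z.2 z.1}].

Definition coupling (R : realType) (X Y : gm_triple R) :
    set (probability (borel (gm_carrier X * gm_carrier Y)%type) R) :=
  [set pi |
    (forall A : set (borel (gm_carrier X)), measurable A ->
       pi (fst @^-1` A) = gm_measure X A) /\
    (forall B : set (borel (gm_carrier Y)), measurable B ->
       pi (snd @^-1` B) = gm_measure Y B)].
Arguments coupling {R} X Y.

Definition GW_cost (R : realType) (X Y : gm_triple R)
    (pi : probability (borel (gm_carrier X * gm_carrier Y)%type) R) : \bar R :=
  (\int[pi \x pi]_z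
     (`|gm_gauge z.1.1 z.2.1 - gm_gauge z.1.2 z.2.2| ^+ 2)%:E)%E.
Arguments GW_cost {R} X Y.

(* Extended-real valued, but finite between gm-spaces. *)
Definition GW (R : realType) (X Y : gm_triple R) : \bar R :=
  ereal_inf [set sqrte (GW_cost X Y pi) | pi in coupling X Y].

Definition simplex (R : realType) (N : nat) : set ('I_N -> R) :=
  [set rho | (forall i, 0 <= rho i <= 1) /\ \sum_i rho i = 1].

Definition barycenter_functional (R : realType) (N : nat) (rho : 'I_N -> R)
    (X : 'I_N -> gm_triple R) (W : gm_triple R) : \bar R :=
  (\sum_(i < N) (rho i)%:E * GW (X i) W ^+ 2)%E.

(* A minimizer over the set of homomorphism classes is expressed through
   representatives: the distance between two classes is, by definition, GW of
   any two representatives. *)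
Definition GW_barycenter (R : realType) (N : nat) (rho : 'I_N -> R)
    (X : 'I_N -> gm_triple R) (Y : gm_triple R) :=
  gm_space Y /\
  forall W : gm_triple R, gm_space W ->
    (barycenter_functional rho X Y <= barycenter_functional rho X W)%E.

Definition multi_carrier (R : realType) (N : nat) (X : 'I_N -> gm_triple R) :
    ptopologicalType :=
  prod_topology (fun i => gm_carrier (X i)).

Definition multi_coupling (R : realType) (N : nat) (X : 'I_N -> gm_triple R) :
    set (probability (borel (multi_carrier X)) R) :=
  [set pi | forall (i : 'I_N) (A : set (borel (gm_carrier (X i)))),
     measurable A ->
     pi ((fun x : multi_carrier X => x i) @^-1` A) = gm_measure (X i) A].
Arguments multi_coupling {R N} X.

Definition multi_GW_cost (R : realType) (N : nat) (rho : 'I_N -> R)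
    (X : 'I_N -> gm_triple R) (pi : probability (borel (multi_carrier X)) R) :
    \bar R :=
  (\int[pi \x pi]_z
     (2^-1 * \sum_(i < N) \sum_(j < N) rho i * rho j *
        `|gm_gauge (z.1 i) (z.2 i) - gm_gauge (z.1 j) (z.2 j)| ^+ 2)%R%:E)%E.
Arguments multi_GW_cost {R N} rho X.

Definition multi_optimal (R : realType) (N : nat) (rho : 'I_N -> R)
    (X : 'I_N -> gm_triple R) : set (probability (borel (multi_carrier X)) R) :=
  [set pi | multi_coupling X pi /\
     forall pi', multi_coupling X pi' ->
       (multi_GW_cost rho X pi <= multi_GW_cost rho X pi')%E].
Arguments multi_optimal {R N} rho X.

Definition dotv (R : realType) (n : nat) (x y : 'cV[R]_n) : R :=
  \sum_(k < n) x k 0 * y k 0.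

(* The case split matters: [normal_prob m 0] is not a Dirac mass. *)
Definition centered_normal (R : realType) (v : R) : set R -> \bar R :=
  if v == 0 then \d_(0 : R)%R else normal_prob 0 (Num.sqrt v).

(* [mu] is N(0, S), with [S] possibly singular, when the law under [mu] of each
   linear form <u, .> is the univariate N(0, u^T S u). *)
Definition is_gaussian (R : realType) (n : nat) (S : 'M[R]_n)
    (mu : probability (borel 'cV[R]_n) R) :=
  [/\ S^T = S,
      forall u : 'cV[R]_n, 0 <= dotv u (S *m u)
    & forall (u : 'cV[R]_n) (B : set R), measurable B ->
        mu (dotv u @^-1` B) = centered_normal (dotv u (S *m u)) B].

Definition euclid_gm (R : realType) (n : nat)
    (mu : probability (borel 'cV[R]_n) R) : gm_triple R :=
  @GMTriple R 'cV[R]_n (@dotv R n) mu.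

Definition orthogonal_mx (R : realType) (n : nat) (P : 'M[R]_n) :=
  P *m P^T = 1%:M.

Definition sign_diag (R : realType) (n : nat) : set 'M[R]_n :=
  [set J | exists2 s : 'rV[R]_n,
     (forall k, s 0 k = -1 \/ s 0 k = 1) & J = diag_mx s].

Definition upper_left (R : realType) (m n : nat) (le_mn : (m <= n)%N)
    (B : 'M[R]_n) : 'M[R]_m :=
  mxsub (widen_ord le_mn) (widen_ord le_mn) B.

(* Square root of a diagonal matrix with nonnegative entries. *)
Definition diag_sqrt (R : realType) (n : nat) (D : 'M[R]_n) : 'M[R]_n :=
  diag_mx (\row_k Num.sqrt (D k k)).

Definition pad_cols (R : realType) (m n : nat) (le_mn : (m <= n)%N)
    (B : 'M[R]_m) : 'M[R]_(m, n) :=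
  castmx (erefl m, subnKC le_mn) (row_mx B (0 : 'M[R]_(m, n - m))).

Definition pad_square (R : realType) (m n : nat) (le_mn : (m <= n)%N)
    (B : 'M[R]_m) : 'M[R]_n :=
  castmx (subnKC le_mn, subnKC le_mn)
    (block_mx B (0 : 'M[R]_(m, n - m)) 0 0).

Definition transport_mx (R : realType) (m n : nat) (le_mn : (m <= n)%N)
    (J D : 'M[R]_m) (D1 : 'M[R]_n) : 'M[R]_(m, n) :=
  pad_cols le_mn (J *m diag_sqrt D *m invmx (diag_sqrt (upper_left le_mn D1))).

(* Main.v *)
(* In principal coordinates Z_i = P_i^T x_i, the gauge of X_i is
   sum_k Z_ik Z_ik', so every cross term of a GW cost is a sum of squared
   cross-covariances: with C_ij = E[Z_i Z_j^T],
     int int <x_i, x_i'> <x_j, x_j'> = |C_ij|^2 (Frobenius norm).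
   Since |u^T C_ij v|^2 <= (u^T D_i u) (v^T D_j v), the matrix with entries
   C_kl^2 / (D_i,kk D_j,ll) is doubly substochastic, and two Abel summations give
   |C_ij|^2 <= sum_k D_i,kk D_j,kk. The maps T_i make all Z_i multiples of the same
   standardized coordinates of xi_1, which turns these bounds into equalities, and
   the multi-marginal optimality follows.

   For the barycenter, no gluing of couplings is needed. Given couplings pi_i of
   X_i with an arbitrary W = (W, h, nu), the cross term of the i-th cost only
   depends on the conditional expectation E_i of Z_i given w, and E_i has covariance
   at most D_i. With G_i = sum_k E_ik E_ik' and G = sum_i rho_i G_i, the weighted
   cost is sum_i rho_i |D_i|^2 - 2 <G, h> + |h|^2 >= sum_i rho_i |D_i|^2 - |G|^2,
   and |G|^2 <= sum_ij rho_i rho_j sum_k D_i,kk D_j,kk by the same inequality. This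
   is the cost of Y, reached by linear images of xi_1.

   That linear images of Gaussians have the prescribed law as Borel measures is the
   Cramer-Wold theorem: one-dimensional projections determine the integrals of
   trigonometric polynomials, whose bounded limits include the indicators of
   half-spaces. *)

Require Import Defs.
From HB Require Import structures.
From mathcomp Require Import all_boot all_order all_algebra.
From mathcomp Require Import all_classical all_reals all_analysis.
From mathcomp Require Import measurable_realfun ring lra.
Import Order.TTheory GRing.Theory Num.Theory.
Import numFieldNormedType.Exports.
Local Open Scope classical_set_scope.
Local Open Scope ring_scope.

Set Implicit Arguments.
Unset Strict Implicit.
Unset Printing Implicit Defensive.

(** * Square-integrable functions and product measures *)

(** [W] is an arbitrary Polish space with an arbitrary gauge, so the only handle on it is that its
    gauge is a function of [(w, w')] alone. Conditional expectations are therefore needed only as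
    objects to be tested against such functions, and Radon-Nikodym densities provide them without
    disintegration. In general the projection destroys the diagonal form of the covariance and
    leaves only the bound by [D_i]. This is why the trace inequality is derived from a bilinear
    bound rather than from an explicit covariance matrix, and why the same inequality serves both
    halves of the theorem.

    At equality everything is Euclidean. In the standardized coordinates the gauge of [X_i] is a
    diagonal kernel whose coefficients are the spectrum of [D_i] padded by zeros, and diagonal
    kernels are isometric to vectors with [d_1] entries. The barycenter is the weighted mean of the
    spectra, and the minimal value is their weighted variance. Since the infimum in GW is not
    assumed to be attained, the lower bound is stated for given couplings and applied to
    near-optimal ones. *)

Section square_integrable.
Context d (T : measurableType d) (R : realType).
Implicit Types (mu : {measure set T -> \bar R}) (f g : T -> R).

Lemma Lfun2P mu f : f \in Lfun mu 2%:E <->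
  measurable_fun setT f /\ (\int[mu]_x ((f x) ^+ 2)%:E < +oo)%E.
Proof.
split=> [f2|[mf fy]].
  split; first by move: f2; rewrite inE => /andP[+ _]; rewrite inE.
  apply: integrable_lty => //; exact: Lfun2_integrable_sqr f2.
rewrite inE; apply/andP; split; rewrite inE//= /finite_norm unlock.
rewrite poweR_lty//; apply: le_lt_trans fy.
by under eq_integral do rewrite /= powR_mulrn// real_normK ?num_real//.
Qed.

Lemma Lfun2_measurable mu f : f \in Lfun mu 2%:E -> measurable_fun setT f.
Proof. by case/Lfun2P. Qed.

Lemma Lfun2_integrableM mu f g : f \in Lfun mu 2%:E -> g \in Lfun mu 2%:E ->
  mu.-integrable setT (EFin \o (fun x => f x * g x)).
Proof. by move=> f2 g2; apply/Lfun1_integrable/Lfun2_mul_Lfun1. Qed.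

Lemma Lfun2D mu f g : f \in Lfun mu 2%:E -> g \in Lfun mu 2%:E ->
  (fun x => f x + g x) \in Lfun mu 2%:E.
Proof. by move=> f2 g2; apply: (rpredD f2 g2); exact: lee1n. Qed.

Lemma Lfun2Z mu f a : f \in Lfun mu 2%:E -> (fun x => a * f x) \in Lfun mu 2%:E.
Proof.
move=> f2.
by have := @Lfun_scale _ _ _ mu f a 2 (ler1n _ 2) f2; under eq_fun do rewrite mulrC.
Qed.

Lemma Lfun2B mu f g : f \in Lfun mu 2%:E -> g \in Lfun mu 2%:E ->
  (fun x => f x - g x) \in Lfun mu 2%:E.
Proof.
move=> f2 g2; have := Lfun2D f2 (Lfun2Z (-1) g2).
by under eq_fun do rewrite mulN1r.
Qed.

Lemma Lfun2_0 mu : (fun=> 0) \in Lfun mu 2%:E.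
Proof.
apply/Lfun2P; split=> //.
by under eq_integral do rewrite expr0n/=; rewrite integral0.
Qed.

Lemma Lfun2_sum mu n (F : 'I_n -> T -> R) (a : 'I_n -> R) :
  (forall i, F i \in Lfun mu 2%:E) ->
  (fun x => \sum_i a i * F i x) \in Lfun mu 2%:E.
Proof.
move=> F2; elim: n F a F2 => [|n IH] F a F2.
  by under eq_fun do rewrite big_ord0; exact: Lfun2_0.
under eq_fun do rewrite big_ord_recl.
by apply: Lfun2D; [exact: Lfun2Z|exact: IH].
Qed.

Lemma le_Lfun2 mu f g : measurable_fun setT f -> (forall x, `|f x| <= `|g x|) ->
  g \in Lfun mu 2%:E -> f \in Lfun mu 2%:E.
Proof.
move=> mf fg /Lfun2P[mg gy]; apply/Lfun2P; split => //.
apply: le_lt_trans gy; apply: ge0_le_integral => //.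
- by move=> x _; rewrite lee_fin sqr_ge0.
- by apply/measurable_EFinP; apply: measurable_funX.
- by apply/measurable_EFinP; apply: measurable_funX.
- move=> x _; rewrite lee_fin -[leLHS]real_normK ?num_real//.
  by rewrite -[leRHS]real_normK ?num_real// lerXn2r ?nnegrE.
Qed.

(** Integrability and value are bundled because nested sums are integrated from the inside out: the
    first half of one application is the hypothesis of the next. *)
Lemma Rintegral_suml mu n (F : 'I_n -> T -> R) (a : 'I_n -> R) :
  (forall i, mu.-integrable setT (EFin \o F i)) ->
  mu.-integrable setT (EFin \o (fun x => \sum_i a i * F i x)) /\
  \int[mu]_x (\sum_i a i * F i x) = \sum_i a i * \int[mu]_x F i x.
Proof.
move=> F2; elim: n F a F2 => [|n IH] F a F2.
  split; last by rewrite big_ord0; under eq_Rintegral do rewrite big_ord0;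
    rewrite Rintegral_cst// mul0r.
  under [X in EFin \o X]eq_fun do rewrite big_ord0.
  exact: integrable0.
have [i1 i2] := IH (fun i => F (lift ord0 i)) (fun i => a (lift ord0 i))
  (fun i => F2 (lift ord0 i)).
have i0 : mu.-integrable setT (EFin \o (fun x => a ord0 * F ord0 x)).
  by have := integrableZl measurableT (a ord0) (F2 ord0).
split; last first.
  under eq_Rintegral do rewrite big_ord_recl.
  by rewrite big_ord_recl RintegralD// RintegralZl// i2.
under [X in EFin \o X]eq_fun do rewrite big_ord_recl.
by have := integrableD measurableT i0 i1.
Qed.

Lemma Rintegral_CauchySchwarz mu f g :
  f \in Lfun mu 2%:E -> g \in Lfun mu 2%:E ->
  (\int[mu]_x (f x * g x)) ^+ 2 <=
  \int[mu]_x (f x ^+ 2) * \int[mu]_x (g x ^+ 2).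
Proof.
move=> f2 g2; set b := Rintegral _ _ _; set a := Rintegral _ _ _.
set c := Rintegral _ _ _.
have iff := Lfun2_integrableM f2 f2.
have ifg := Lfun2_integrableM f2 g2.
have igg := Lfun2_integrableM g2 g2.
have c0 : 0 <= c by apply: Rintegral_ge0 => x _; exact: sqr_ge0.
have quad s t : 0 <= s ^+ 2 * a - 2 * s * t * b + t ^+ 2 * c.
  have -> : s ^+ 2 * a - 2 * s * t * b + t ^+ 2 * c =
      \int[mu]_x ((s * f x - t * g x) ^+ 2).
    pose F := fun i : 'I_3 => nth (fun=> 0)
      [:: (fun x => f x * f x); (fun x => f x * g x); (fun x => g x * g x)] i.
    pose w := fun i : 'I_3 => nth 0 [:: s ^+ 2; - (2 * s * t); t ^+ 2] i.
    have Fint i : mu.-integrable setT (EFin \o F i) by case: i => -[|[|[|]]].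
    have [_] := Rintegral_suml w Fint.
    rewrite ![in RHS]big_ord_recl big_ord0/= addr0 addrA mulNr => <-.
    by apply: eq_Rintegral => x _; rewrite !big_ord_recl big_ord0 /w/F/=; ring.
  by apply: Rintegral_ge0 => x _; exact: sqr_ge0.
have [c_eq0|c_neq0] := eqVneq c 0.
  (* For [c = 0] the form is affine in [t], and this [t] gives it the value -1 unless [b = 0]. *)
  have := quad 1 ((a + 1) / (2 * b)); rewrite c_eq0.
  have [->|b0] := eqVneq b 0; first by move=> _; rewrite expr0n mulr0.
  have -> : 1 ^+ 2 * a - 2 * 1 * ((a + 1) / (2 * b)) * b +
    ((a + 1) / (2 * b)) ^+ 2 * 0 = -1 by field.
  by rewrite oppr_ge0 ler10.
have c_gt0 : 0 < c by rewrite lt_neqAle eq_sym c_neq0.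
have := quad c b.
have -> : c ^+ 2 * a - 2 * c * b * b + b ^+ 2 * c = c * (a * c - b ^+ 2) by ring.
by rewrite pmulr_rge0// subr_ge0.
Qed.

End square_integrable.

(** A relation between two given measures, compared on measurable sets only: marginals of couplings
    and Gaussian images are prescribed measures, not syntactic push-forwards. *)
Definition is_image d1 d2 (T1 : measurableType d1) (T2 : measurableType d2)
    (R : realType) (m1 : {measure set T1 -> \bar R}) (q : T1 -> T2)
    (m2 : {measure set T2 -> \bar R}) :=
  measurable_fun setT q /\
  forall A, measurable A -> m2 A = m1 (q @^-1` A).

Section image.
Context d1 d2 (T1 : measurableType d1) (T2 : measurableType d2) (R : realType).
Variables (m1 : {measure set T1 -> \bar R}) (m2 : {measure set T2 -> \bar R}).
Variable q : T1 -> T2.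
Hypothesis q12 : is_image m1 q m2.

Lemma ge0_integral_image (f : T2 -> \bar R) :
  measurable_fun setT f -> (forall y, 0 <= f y)%E ->
  (\int[m2]_y f y = \int[m1]_x f (q x))%E.
Proof.
case: q12 => mq qE mf f0.
pose Q := mfun_Sub (mem_set mq : q \in mfun).
rewrite (@eq_measure_integral _ _ _ setT (pushforward m1 Q)); last first.
  by move=> A mA _; rewrite /= /pushforward -qE.
rewrite (ge0_integral_pushforward (mq : measurable_fun setT Q))//.
Qed.

Lemma Rintegral_image (f : T2 -> R) : measurable_fun setT f ->
  \int[m2]_y f y = \int[m1]_x f (q x).
Proof.
case: q12 => mq qE mf; rewrite /Rintegral [in LHS]integralE [in RHS]integralE.
congr (fine (_ - _)%E).
- rewrite (@ge0_integral_image ((fun x => (f x)%:E)^\+)%E)//.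
    by apply: eq_integral => x _; rewrite !funeposE.
  by apply: measurable_funepos; exact/measurable_EFinP.
- rewrite (@ge0_integral_image ((fun x => (f x)%:E)^\-)%E)//.
    by apply: eq_integral => x _; rewrite !funenegE.
  by apply: measurable_funeneg; exact/measurable_EFinP.
Qed.

Lemma image_Lfun2 (f : T2 -> R) :
  f \in Lfun m2 2%:E -> (f \o q) \in Lfun m1 2%:E.
Proof.
case: q12 => mq qE /Lfun2P[mf fy]; apply/Lfun2P; split.
  exact: measurableT_comp.
rewrite -(@ge0_integral_image (fun y => (f y ^+ 2)%:E))//.
  by apply/measurable_EFinP; exact: measurable_funX.
by move=> y; rewrite lee_fin sqr_ge0.
Qed.

End image.

Section product_measure.
Context d1 d2 (T1 : measurableType d1) (T2 : measurableType d2) (R : realType).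
Variables (P1 : probability T1 R) (P2 : probability T2 R).

(** Both measures agree on rectangles, which determines a product of probability measures. This
    carries double integrals of gauges from a coupling to its marginals. *)
Lemma is_image_prod (q : T1 -> T2) : is_image P1 q P2 ->
  is_image (P1 \x P1)%E (fun z => (q z.1, q z.2)) (P2 \x P2)%E.
Proof.
case=> mq qE; set q2 := fun z => _.
have mq2 : measurable_fun [set: T1 * T1] q2.
  by apply: measurable_fun_pair; apply: (measurableT_comp mq).
split=> // A mA.
pose Q := mfun_Sub (mem_set mq2 : q2 \in mfun).
apply: (@product_measure_unique _ _ _ _ _ P2 P2
  (pushforward (P1 \x P1)%E Q)) => //.
move=> B C mB mC.
have mqB : measurable (q @^-1` B) by rewrite -[X in measurable X]setTI; exact: mq.
have mqC : measurable (q @^-1` C) by rewrite -[X in measurable X]setTI; exact: mq.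
rewrite /= /pushforward !qE// -product_measure1E//.
Qed.

End product_measure.

(** * Tensor kernels and gauges over the square of a probability space *)

Section tensor.
Context d (T : measurableType d) (R : realType) (P : probability T R).
Implicit Types f g : T -> R.

Lemma measurable_tensor f g : measurable_fun setT f -> measurable_fun setT g ->
  measurable_fun setT (fun z : T * T => f z.1 * g z.2).
Proof.
move=> mf mg; apply: measurable_funM.
  exact: (measurableT_comp mf).
exact: (measurableT_comp mg).
Qed.

Lemma tensor_integrable f g :
  P.-integrable setT (EFin \o f) -> P.-integrable setT (EFin \o g) ->
  (P \x P)%E.-integrable setT (EFin \o (fun z : T * T => f z.1 * g z.2)).
Proof.
move=> /[dup] fi /integrableP[/measurable_EFinP mf fy].
move=> /[dup] gi /integrableP[/measurable_EFinP mg gy].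
apply/integrable12ltyP.
  by apply/measurable_EFinP; exact: measurable_tensor.
rewrite (_ : (\int[P]_x _ = \int[P]_x
    (`|(f x)%:E| * \int[P]_y `|(g y)%:E|))%E); last first.
  apply: eq_integral => x _; rewrite -ge0_integralZl//=.
    by apply: eq_integral => y _; rewrite normrM EFinM.
  by apply/measurable_EFinP; exact: measurableT_comp.
rewrite ge0_integralZr//; last first.
- by apply: integral_ge0.
- by apply: measurableT_comp => //; exact/measurable_EFinP.
by rewrite lte_mul_pinfty// ?integral_ge0// ge0_fin_numE// integral_ge0.
Qed.

Lemma Rintegral_tensor f g :
  P.-integrable setT (EFin \o f) -> P.-integrable setT (EFin \o g) ->
  Rintegral (P \x P)%E setT (fun z : T * T => f z.1 * g z.2) =
  \int[P]_x f x * \int[P]_x g x.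
Proof.
move=> fi gi; rewrite /Rintegral.
rewrite -(integral12_prod_meas1 (tensor_integrable fi gi)) /fubini_F/=.
rewrite (_ : (\int[P]_x _ = \int[P]_x ((f x)%:E * \int[P]_y (g y)%:E))%E); last first.
  apply: eq_integral => x _; rewrite -integralZl//=.
have gfin := integrable_fin_num measurableT gi.
rewrite -(fineK gfin) integralZr//= fineM//.
exact: (integrable_fin_num measurableT fi).
Qed.

Lemma tensor_Lfun2 f g : f \in Lfun P 2%:E -> g \in Lfun P 2%:E ->
  (fun z : T * T => f z.1 * g z.2) \in Lfun (P \x P)%E 2%:E.
Proof.
move=> f2 g2; apply/Lfun2P; split.
  by apply: measurable_tensor; [exact: Lfun2_measurable f2|exact: Lfun2_measurable g2].
apply: integrable_lty => //.
have := tensor_integrable (Lfun2_integrable_sqr f2) (Lfun2_integrable_sqr g2).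
by under eq_fun do rewrite /= -exprMn.
Qed.

End tensor.

Section gauge.
Context d (T : measurableType d) (R : realType) (P : probability T R).

(** The symmetric kernel with coefficients [a] on the tensor squares of the [Z k]. Unit coefficients
    give a scalar product read in coordinates; spectra as coefficients give the same scalar product
    in standardized coordinates. *)
Definition gauge_of n (a : 'I_n -> R) (Z : 'I_n -> T -> R) (z : T * T) : R :=
  \sum_k a k * (Z k z.1 * Z k z.2).

Lemma gauge_of_Lfun2 n (a : 'I_n -> R) (Z : 'I_n -> T -> R) :
  (forall k, Z k \in Lfun P 2%:E) -> gauge_of a Z \in Lfun (P \x P)%E 2%:E.
Proof. by move=> Z2; apply: Lfun2_sum => k; exact: tensor_Lfun2. Qed.

(** By Fubini the integral of [Y k z.1 * Z l z.1 * Y k z.2 * Z l z.2] splits into two equal factors,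
    hence the squares. *)
Lemma Rintegral_gauge_of m n (a : 'I_m -> R) (Y : 'I_m -> T -> R)
    (b : 'I_n -> R) (Z : 'I_n -> T -> R) :
  (forall k, Y k \in Lfun P 2%:E) -> (forall k, Z k \in Lfun P 2%:E) ->
  Rintegral (P \x P)%E setT (fun z => gauge_of a Y z * gauge_of b Z z) =
  \sum_k \sum_l a k * b l * (\int[P]_x (Y k x * Z l x)) ^+ 2.
Proof.
move=> Y2 Z2.
have YZi k l := Lfun2_integrableM (Y2 k) (Z2 l).
transitivity (Rintegral (P \x P)%E setT (fun z => \sum_k 1 * \sum_l
    (a k * b l) * ((Y k z.1 * Z l z.1) * (Y k z.2 * Z l z.2)))).
  apply: eq_Rintegral => z _; rewrite /gauge_of mulr_suml.
  apply: eq_bigr => k _; rewrite mulr_sumr mul1r; apply: eq_bigr => l _; ring.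
have H k := Rintegral_suml (fun l => a k * b l)
  (fun l => tensor_integrable (YZi k l) (YZi k l)).
rewrite (Rintegral_suml _ (fun k => (H k).1)).2.
apply: eq_bigr => k _; rewrite mul1r (H k).2.
apply: eq_bigr => l _; rewrite expr2.
by have -> := Rintegral_tensor (YZi k l) (YZi k l).
Qed.

End gauge.

(** * Conditional expectations *)

Section ge0_integral_weight.
Context d1 d2 (T1 : measurableType d1) (T2 : measurableType d2) (R : realType).
Variables (m1 : {measure set T1 -> \bar R}) (m2 : {measure set T2 -> \bar R}).
Variables (q : T1 -> T2) (f : T1 -> R) (e : T2 -> R).
Hypotheses (mq : measurable_fun setT q) (mf : measurable_fun setT f)
  (me : measurable_fun setT e) (f0 : forall x, 0 <= f x) (e0 : forall y, 0 <= e y).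
Hypothesis feE : forall A, measurable A ->
  (\int[m1]_(x in q @^-1` A) (f x)%:E = \int[m2]_(y in A) (e y)%:E)%E.

Import HBNNSimple.

Let ge0_integral_weight_nnsfun (h : {nnsfun T2 >-> R}) :
  (\int[m1]_x ((h (q x))%:E * (f x)%:E) = \int[m2]_y ((h y)%:E * (e y)%:E))%E.
Proof.
have hE y : (h y)%:E = (\sum_(r \in range h) (r * \1_(h @^-1` [set r]) y)%:E)%E.
  by rewrite [in LHS]fimfunE -fsumEFin.
have mh r : measurable (h @^-1` [set r]) by [].
have mqh r : measurable (q @^-1` (h @^-1` [set r])).
  by rewrite -[X in measurable X]setTI; exact: mq.
have h0 r : range h r -> 0 <= r by move=> [y _ <-].
transitivity (\int[m1]_x \sum_(r \in range h)
    (r%:E * (\1_(q @^-1` (h @^-1` [set r])) x * f x)%:E))%E.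
  apply: eq_integral => x _; rewrite hE ge0_mule_fsuml; last first.
    by move=> r; exact: nnfun_muleindic_ge0.
  by apply: eq_fsbigr => r _; rewrite -!EFinM mulrA.
transitivity (\int[m2]_y \sum_(r \in range h)
    (r%:E * (\1_(h @^-1` [set r]) y * e y)%:E))%E; last first.
  apply: eq_integral => y _; rewrite hE ge0_mule_fsuml; last first.
    by move=> r; exact: nnfun_muleindic_ge0.
  by apply: eq_fsbigr => r _; rewrite -!EFinM mulrA.
have m1r r : measurable_fun setT
    (fun x => (\1_(q @^-1` (h @^-1` [set r])) x * f x)%:E).
  by apply/measurable_EFinP; apply: measurable_funM => //; exact: measurable_indic.
have m2r r : measurable_fun setT (fun y => (\1_(h @^-1` [set r]) y * e y)%:E).
  by apply/measurable_EFinP; apply: measurable_funM => //; exact: measurable_indic.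
have h01 r y : 0 <= r * \1_(h @^-1` [set r]) y.
  by have := nnfun_muleindic_ge0 h r y; rewrite -EFinM lee_fin.
have p2r r y : (0 <= r%:E * (\1_(h @^-1` [set r]) y * e y)%:E)%E.
  by rewrite -EFinM mulrA lee_fin mulr_ge0.
have p1r r x : (0 <= r%:E * (\1_(q @^-1` (h @^-1` [set r])) x * f x)%:E)%E.
  by rewrite -EFinM mulrA lee_fin mulr_ge0// (h01 r (q x)).
rewrite !ge0_integral_fsum//; last 2 first.
- by move=> r; apply: emeasurable_funM.
- by move=> r; apply: emeasurable_funM.
apply: eq_fsbigr => r /[!inE] rh.
rewrite !ge0_integralZl//; last 4 first.
- by move=> y _; rewrite lee_fin mulr_ge0.
- by rewrite lee_fin h0.
- by move=> y _; rewrite lee_fin mulr_ge0.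
- by rewrite lee_fin h0.
congr (_ * _)%E.
have := feE (mh r); rewrite [LHS]integral_mkcond [RHS]integral_mkcond.
rewrite !epatch_indic => E; under eq_integral do rewrite EFinM muleC.
by rewrite E; apply: eq_integral => y _; rewrite EFinM muleC.
Qed.

(** [feE] says that [q] carries the measure with density [f] to the measure with density [e]. It
    extends to simple functions by linearity and to all nonnegative ones by monotone convergence. *)
Lemma ge0_integral_weight (phi : T2 -> \bar R) : measurable_fun setT phi ->
  (forall y, 0 <= phi y)%E ->
  (\int[m1]_x (phi (q x) * (f x)%:E) = \int[m2]_y (phi y * (e y)%:E))%E.
Proof.
move=> mphi phi0; pose h := nnsfun_approx measurableT mphi.
have phiE y : phi y = limn (fun n => (h n y)%:E).
  by apply/esym/cvg_lim => //; exact: cvg_nnsfun_approx.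
have hc y : cvgn (fun n => (h n y)%:E).
  by apply/cvg_ex; exists (phi y); exact: cvg_nnsfun_approx.
have hnd n m y : (n <= m)%N -> h n y <= h m y.
  by move=> nm; exact/lefP/nd_nnsfun_approx.
transitivity (\int[m1]_x limn (fun n => (h n (q x))%:E * (f x)%:E))%E.
  apply: eq_integral => x _; rewrite phiE; apply/esym/cvg_lim => //.
  by apply: cvgeZr => //; exact: hc.
transitivity (\int[m2]_y limn (fun n => (h n y)%:E * (e y)%:E))%E; last first.
  apply: eq_integral => y _; rewrite phiE; apply/cvg_lim => //.
  by apply: cvgeZr => //; exact: hc.
rewrite !monotone_convergence//.
- by congr (limn _); apply/funext => n; exact: ge0_integral_weight_nnsfun.
- by move=> n; apply: emeasurable_funM; exact/measurable_EFinP.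
- by move=> n y _; rewrite mule_ge0 ?lee_fin.
- by move=> y _ n m nm; rewrite lee_wpmul2r ?lee_fin ?hnd.
- move=> n; apply: emeasurable_funM; last exact/measurable_EFinP.
  by apply/measurable_EFinP; exact: measurableT_comp.
- by move=> n y _; rewrite mule_ge0 ?lee_fin.
- by move=> y _ n m nm; rewrite lee_wpmul2r ?lee_fin ?hnd.
Qed.

End ge0_integral_weight.

(** When [m2] is the image of [m1] under [q], the function [e \o q] is the orthogonal projection of
    [f] on the square-integrable functions of [q], that is, the conditional expectation of [f] given
    [q]. *)
Definition L2_projection d1 d2 (T1 : measurableType d1) (T2 : measurableType d2)
    (R : realType) (m1 : {measure set T1 -> \bar R}) (q : T1 -> T2)
    (m2 : {measure set T2 -> \bar R}) (f : T1 -> R) (e : T2 -> R) :=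
  [/\ f \in Lfun m1 2%:E, e \in Lfun m2 2%:E &
    forall phi, phi \in Lfun m2 2%:E ->
      \int[m1]_x (f x * phi (q x)) = \int[m2]_y (e y * phi y)].

(** Here the test functions are nonnegative and may be infinite, so that the partial integrals
    produced by Tonelli's theorem are again test functions. *)
Definition ge0_projection d1 d2 (T1 : measurableType d1) (T2 : measurableType d2)
    (R : realType) (m1 : {measure set T1 -> \bar R}) (q : T1 -> T2)
    (m2 : {measure set T2 -> \bar R}) (f : T1 -> R) (e : T2 -> R) :=
  [/\ forall x, 0 <= f x, forall y, 0 <= e y,
      f \in Lfun m1 2%:E, e \in Lfun m2 2%:E &
    forall phi : T2 -> \bar R, measurable_fun setT phi ->
      (forall y, 0 <= phi y)%E ->
      (\int[m1]_x (phi (q x) * (f x)%:E) = \int[m2]_y (phi y * (e y)%:E))%E].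

Section L2_projection_linear.
Context d1 d2 (T1 : measurableType d1) (T2 : measurableType d2) (R : realType).
Variables (m1 : {measure set T1 -> \bar R}) (m2 : {measure set T2 -> \bar R}).
Variable q : T1 -> T2.
Hypothesis q12 : is_image m1 q m2.
Local Notation proj := (L2_projection m1 q m2).

Lemma L2_projection_sum n (a : 'I_n -> R) (F : 'I_n -> T1 -> R)
    (E : 'I_n -> T2 -> R) : (forall k, proj (F k) (E k)) ->
  proj (fun x => \sum_k a k * F k x) (fun y => \sum_k a k * E k y).
Proof.
move=> FE; split; [by apply: Lfun2_sum => k; case: (FE k)..|].
move=> phi phi2; have phiq2 := image_Lfun2 q12 phi2.
have Fi k : m1.-integrable setT (EFin \o (fun x => F k x * phi (q x))).
  by case: (FE k) => Fk _ _; exact: (Lfun2_integrableM Fk phiq2).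
have Ei k : m2.-integrable setT (EFin \o (fun y => E k y * phi y)).
  by case: (FE k) => _ Ek _; exact: (Lfun2_integrableM Ek phi2).
transitivity (\int[m1]_x (\sum_k a k * (F k x * phi (q x)))).
  apply: eq_Rintegral => x _; rewrite mulr_suml.
  by apply: eq_bigr => k _; rewrite mulrA.
transitivity (\int[m2]_y (\sum_k a k * (E k y * phi y))); last first.
  apply: eq_Rintegral => y _; rewrite mulr_suml.
  by apply: eq_bigr => k _; rewrite mulrA.
rewrite (Rintegral_suml a Fi).2 (Rintegral_suml a Ei).2.
by apply: eq_bigr => k _; case: (FE k) => _ _ ->.
Qed.

(** Testing the projection with [e] itself and applying Cauchy-Schwarz gives [a ^+ 2 <= b * a]. *)
Lemma L2_projection_le f e : proj f e ->
  \int[m2]_y (e y ^+ 2) <= \int[m1]_x (f x ^+ 2).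
Proof.
case=> f2 e2 fe.
set a := Rintegral _ _ _; set b := Rintegral _ _ _.
have a0 : 0 <= a by apply: Rintegral_ge0 => y _; exact: sqr_ge0.
have : a ^+ 2 <= b * a.
  have := Rintegral_CauchySchwarz f2 (image_Lfun2 q12 e2).
  rewrite (fe _ e2) -(@Rintegral_image _ _ _ _ _ _ _ _ q12 (fun y => e y ^+ 2))//.
  by apply: measurable_funX; exact: (Lfun2_measurable e2).
have [->|a_neq0] := eqVneq a 0.
  by move=> _; apply: Rintegral_ge0 => x _; exact: sqr_ge0.
by rewrite expr2 ler_pM2r// lt_neqAle eq_sym a_neq0.
Qed.

(** As [f] and [e] are nonnegative, the positive part of [f x * psi (q x)] is [f x] times that of
    [psi (q x)], a legitimate nonnegative test. Using it for [phi] and [- phi] covers both parts. *)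
Lemma ge0_projection_L2 f e : ge0_projection m1 q m2 f e -> proj f e.
Proof.
case=> f0 e0 f2 e2 fe; split=> // phi phi2.
have mphi := Lfun2_measurable phi2.
have mf := Lfun2_measurable f2; have me := Lfun2_measurable e2.
have part psi : measurable_fun setT psi ->
    (\int[m1]_x maxe (f x * psi (q x))%:E 0 = \int[m2]_y maxe (e y * psi y)%:E 0)%E.
  move=> mpsi; have psi0 y : (0 <= maxe (psi y)%:E 0)%E by rewrite le_max lexx orbT.
  have mpsi0 : measurable_fun setT (fun y => maxe (psi y)%:E 0).
    by apply: measurable_maxe => //; exact/measurable_EFinP.
  have max_mul (r s : R) : 0 <= r -> maxe (r * s)%:E 0 = (maxe s%:E 0 * r%:E)%E.
    by move=> r0; rewrite -!EFin_max -EFinM maxr_pMl// mul0r mulrC.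
  under eq_integral do rewrite max_mul//.
  by rewrite (fe _ mpsi0 psi0); apply: eq_integral => y _; rewrite max_mul.
rewrite /Rintegral [in LHS]integralE [in RHS]integralE; congr (fine (_ - _)%E).
- under eq_integral do rewrite funeposE; rewrite part//.
  by apply: eq_integral => y _; rewrite funeposE.
- under eq_integral do rewrite funenegE -EFinN -mulrN.
  rewrite (part (fun y => - phi y)); last exact: measurableT_comp.
  by apply: eq_integral => y _; rewrite funenegE -EFinN -mulrN.
Qed.

End L2_projection_linear.

Section ge0_projection_exists.
Context d1 d2 (T1 : measurableType d1) (T2 : measurableType d2) (R : realType).
Variables (P1 : probability T1 R) (P2 : probability T2 R) (q : T1 -> T2).
Hypothesis q12 : is_image P1 q P2.
Variable f : T1 -> R.
Hypotheses (f0 : forall x, 0 <= f x) (f2 : f \in Lfun P1 2%:E).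

Let mf : measurable_fun setT f. Proof. exact: (Lfun2_measurable f2). Qed.

Let fi : P1.-integrable setT (EFin \o f).
Proof.
by apply/Lfun1_integrable; apply: Lfun_subset12 f2; exact: fin_num_measure.
Qed.

Let mqA A : measurable A -> measurable (q @^-1` A).
Proof. by case: q12 => mq _ mA; rewrite -[X in measurable X]setTI; exact: mq. Qed.

(** The image under [q] of the measure with density [f]; its density with respect to [P2] is the
    conditional expectation. *)
Let weighted_image (A : set T2) : \bar R := (\int[P1]_(x in q @^-1` A) (f x)%:E)%E.

Let weighted_image0 : weighted_image set0 = 0%E.
Proof. by rewrite /weighted_image preimage_set0 integral_set0. Qed.

Let weighted_image_ge0 A : (0 <= weighted_image A)%E.
Proof. by apply: integral_ge0 => x _; rewrite lee_fin. Qed.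

Let weighted_image_semi_sigma_additive : semi_sigma_additive weighted_image.
Proof.
move=> F mF tF mUF; rewrite /weighted_image preimage_bigcup.
rewrite ge0_integral_bigcup//=.
- by apply: is_cvg_ereal_nneg_natsum_cond => n _ _; exact: weighted_image_ge0.
- by move=> n; exact: mqA.
- exact/measurable_EFinP/measurable_funTS.
- by move=> x _; rewrite lee_fin.
- apply/trivIsetP => i j _ _ ij; rewrite -preimage_setI.
  by move/trivIsetP : tF => ->//; rewrite preimage_set0.
Qed.

HB.instance Definition _ := isMeasure.Build _ _ _ weighted_image
  weighted_image0 weighted_image_ge0 weighted_image_semi_sigma_additive.

Let weighted_image_finite : fin_num_fun weighted_image.
Proof.
move=> A mA; apply: integrable_fin_num; first exact: mqA.
by apply: (integrableS measurableT) => //; exact: mqA.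
Qed.

HB.instance Definition _ := @Measure_isFinite.Build _ _ _ weighted_image
  weighted_image_finite.

(** The Radon-Nikodym density is a priori only integrable. Most of the work bounds its truncations
    in L2 uniformly, after which monotone convergence gives square integrability. *)
Lemma ge0_projection_exists : exists e, ge0_projection P1 q P2 f e.
Proof.
case: (q12) => mq qE.
have dom : weighted_image `<< P2.
  apply/null_content_dominatesP => A mA A0.
  have {}A0 : P1 (q @^-1` A) = 0%E by rewrite -qE.
  by apply: null_set_integral => //; [exact: mqA|exact/measurable_EFinP/measurable_funTS].
have [e' [e'0 e'fin e'i e'E]] := radon_nikodym_sigma_finite dom.
pose e y := fine (e' y).
have e'e y : e' y = (e y)%:E by rewrite fineK.
have e0 y : 0 <= e y by rewrite fine_ge0.
have me : measurable_fun setT e.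
  apply/measurable_EFinP; rewrite (_ : _ \o _ = e'); first exact: (measurable_int _ e'i).
  by apply/funext => y; rewrite e'e.
have feE A : measurable A ->
    (\int[P1]_(x in q @^-1` A) (f x)%:E = \int[P2]_(y in A) (e y)%:E)%E.
  move=> mA; rewrite -[LHS]/(weighted_image A) e'E ?inE//.
  by apply: eq_integral => y _; rewrite e'e.
have fe := ge0_integral_weight mq mf me f0 e0 feE.
exists e; split=> //; apply/Lfun2P; split=> //.
set F := (\int[P1]_x ((f x) ^+ 2)%:E)%E.
have F_fin : F \is a fin_num.
  by apply: (integrable_fin_num measurableT); exact: Lfun2_integrable_sqr f2.
(* [2 phi f <= phi^2 + f^2], integrated, bounds the truncations [phi] of [e] in L2
   by [f]. *)
pose phi n y := Num.min (e y) n%:R.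
have phi0 n y : 0 <= phi n y by rewrite /phi le_min e0 ler0n.
have mphi n : measurable_fun setT (phi n).
  exact: measurable_minr.
have mphiX n : measurable_fun setT (fun y => phi n y ^+ 2) by exact: measurable_funX.
have phi_le n : (\int[P2]_y ((phi n y) ^+ 2)%:E <= F)%E.
  set I := integral _ _ _.
  have I_fin : I \is a fin_num.
    rewrite ge0_fin_numE; last by apply: integral_ge0 => y _; rewrite lee_fin sqr_ge0.
    apply: (@le_lt_trans _ _ (\int[P2]_y ((n%:R : R) ^+ 2)%:E)%E).
      apply: ge0_le_integral => //.
      - by move=> y _; rewrite lee_fin sqr_ge0.
      - exact/measurable_EFinP.
      - by move=> y _; rewrite lee_fin lerXn2r ?nnegrE// ge_min lexx orbT.
    by rewrite integral_cst//= probability_setT mule1 ltry.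
  (* The truncation makes [I] finite, so that it may be cancelled. *)
  have : (I + I <= I + F)%E; last by rewrite leeD2lE.
  have -> : (I + I = \int[P2]_y ((phi n y) ^+ 2 + (phi n y) ^+ 2)%:E)%E.
    under [RHS]eq_integral do rewrite EFinD.
    by rewrite ge0_integralD//; (try by move=> y _; rewrite lee_fin sqr_ge0);
      exact/measurable_EFinP.
  have -> : (I + F = \int[P1]_x ((phi n (q x)) ^+ 2 + (f x) ^+ 2)%:E)%E.
    rewrite /I (ge0_integral_image q12 (f := fun y => ((phi n y) ^+ 2)%:E)).
    - under [RHS]eq_integral do rewrite EFinD.
      rewrite ge0_integralD//; (try by move=> x _; rewrite lee_fin sqr_ge0).
      + by apply/measurable_EFinP; apply: (measurableT_comp (mphiX n)).
      + by apply/measurable_EFinP; exact: measurable_funX.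
    - exact/measurable_EFinP.
    - by move=> y; rewrite lee_fin sqr_ge0.
  apply: (@le_trans _ _ (\int[P2]_y ((phi n y *+ 2)%:E * (e y)%:E))%E).
    apply: ge0_le_integral => //.
    - by move=> y _; rewrite lee_fin addr_ge0// sqr_ge0.
    - by apply/measurable_EFinP; exact: measurable_funD.
    - by apply: emeasurable_funM; apply/measurable_EFinP => //; exact: measurable_funD.
    - move=> y _; rewrite -EFinM lee_fin mulrnAl -mulr2n lerMn2r/=.
      by rewrite expr2 ler_wpM2l// ge_min lexx.
  rewrite -(fe (fun y => (phi n y *+ 2)%:E)).
  - apply: ge0_le_integral => //.
    - by move=> x _; rewrite mule_ge0 ?lee_fin// mulrn_wge0.
    - apply: emeasurable_funM; apply/measurable_EFinP => //.
      by apply: (measurableT_comp (f := fun y => phi n y *+ 2)) => //; exact: measurable_funD.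
    - apply/measurable_EFinP; apply: measurable_funD; last exact: measurable_funX.
      by apply: (measurableT_comp (mphiX n)).
    - move=> x _; rewrite -EFinM lee_fin -subr_ge0.
      suff -> : phi n (q x) ^+ 2 + f x ^+ 2 - phi n (q x) *+ 2 * f x =
        (phi n (q x) - f x) ^+ 2 by exact: sqr_ge0.
      by ring.
  - by apply/measurable_EFinP; exact: measurable_funD.
  - by move=> y; rewrite lee_fin mulrn_wge0.
apply: (@le_lt_trans _ _ F); last by rewrite ltey_eq F_fin.
have limE y : ((e y ^+ 2)%:E = limn (fun n => (phi n y ^+ 2)%:E))%E.
  apply/esym/cvg_lim => //; apply: cvg_near_cst.
  near=> n; rewrite /phi min_l//.
  near: n; exact: nbhs_infty_ger.
under eq_integral do rewrite limE.
rewrite monotone_convergence//.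
- apply: lime_le; last by apply: nearW => n; exact: phi_le.
  apply: ereal_nondecreasing_is_cvgn => n m nm.
  apply: ge0_le_integral => //.
  + by move=> y _; rewrite lee_fin sqr_ge0.
  + exact/measurable_EFinP.
  + exact/measurable_EFinP.
  + move=> y _; rewrite lee_fin lerXn2r ?nnegrE// /phi le_min ge_min lexx/=.
    by rewrite ge_min ler_nat nm orbT.
- by move=> n; exact/measurable_EFinP.
- by move=> n y _; rewrite lee_fin sqr_ge0.
- move=> y _ n m nm; rewrite lee_fin lerXn2r ?nnegrE// /phi le_min ge_min lexx/=.
  by rewrite ge_min ler_nat nm orbT.
Unshelve. all: by end_near. Qed.

End ge0_projection_exists.

Section L2_projection_gauge.
Context d1 d2 (T1 : measurableType d1) (T2 : measurableType d2) (R : realType).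
Variables (P1 : probability T1 R) (P2 : probability T2 R) (q : T1 -> T2).
Hypothesis q12 : is_image P1 q P2.
Local Notation q2 := (fun z : T1 * T1 => (q z.1, q z.2)).

(** One variable is projected at a time: for fixed [x] the section of [phi] at [q x] is a test
    function for [g], and the resulting partial integral [psi] is a test function for [f]. *)
Lemma ge0_projection_tensor f e g h :
  ge0_projection P1 q P2 f e -> ge0_projection P1 q P2 g h ->
  ge0_projection (P1 \x P1)%E q2 (P2 \x P2)%E
    (fun z => f z.1 * g z.2) (fun z => e z.1 * h z.2).
Proof.
move=> [f0 e0 f2 e2 fe] [g0 h0 g2 h2 gh]; split.
- by move=> z; rewrite mulr_ge0.
- by move=> z; rewrite mulr_ge0.
- exact: tensor_Lfun2.
- exact: tensor_Lfun2.
move=> phi mphi phi0.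
have [mq2 _] := is_image_prod q12.
have mF : measurable_fun setT
    (fun z : T1 * T1 => phi (q2 z) * (f z.1 * g z.2)%:E)%E.
  apply: emeasurable_funM; first exact: (measurableT_comp mphi mq2).
  by apply/measurable_EFinP; apply: measurable_tensor;
    [exact: (Lfun2_measurable f2)|exact: (Lfun2_measurable g2)].
have mG : measurable_fun setT
    (fun z : T2 * T2 => phi z * (e z.1 * h z.2)%:E)%E.
  apply: emeasurable_funM => //.
  by apply/measurable_EFinP; apply: measurable_tensor;
    [exact: (Lfun2_measurable e2)|exact: (Lfun2_measurable h2)].
rewrite (fubini_tonelli1 _ mF); last by move=> z; rewrite mule_ge0// lee_fin mulr_ge0.
rewrite (fubini_tonelli1 _ mG); last by move=> z; rewrite mule_ge0// lee_fin mulr_ge0.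
rewrite /fubini_F/=.
have mphih : measurable_fun setT (fun z : T2 * T2 => phi z * (h z.2)%:E)%E.
  apply: emeasurable_funM => //; apply/measurable_EFinP.
  exact: (measurableT_comp (Lfun2_measurable h2)).
have phih0 z : (0 <= phi z * (h z.2)%:E)%E by rewrite mule_ge0// lee_fin.
pose psi (x : T2) := (\int[P2]_y (phi (x, y) * (h y)%:E))%E.
have mpsi : measurable_fun setT psi.
  exact: (measurable_fun_fubini_tonelli_F (m2 := P2) _ mphih phih0).
have psi0 x : (0 <= psi x)%E by apply: integral_ge0 => y _; exact: (phih0 (x, y)).
have mphi1 x : measurable_fun setT (fun y => phi (x, y)).
  exact: (measurable_fun_pair2 _ mphi).
transitivity (\int[P1]_x (psi (q x) * (f x)%:E))%E.
  apply: eq_integral => x _; rewrite /psi -(gh (fun y => phi (q x, y)))//.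
  rewrite -ge0_integralZr//.
  - by apply: eq_integral => y _; rewrite EFinM (muleC (f x)%:E) muleA.
  - apply: emeasurable_funM; first exact: (measurableT_comp (mphi1 _) q12.1).
    by apply/measurable_EFinP; exact: (Lfun2_measurable g2).
  - by move=> y _; rewrite mule_ge0// lee_fin.
  - by rewrite lee_fin.
rewrite fe//; apply: eq_integral => x _; rewrite /psi -ge0_integralZr//.
- by apply: eq_integral => y _; rewrite EFinM (muleC (e x)%:E) muleA.
- apply: emeasurable_funM => //.
  by apply/measurable_EFinP; exact: (Lfun2_measurable h2).
- by rewrite lee_fin.
Qed.

(* Positive and negative parts are projected separately, so that products of
   projections are handled by Tonelli's theorem alone. *)
Lemma ge0_projection_decomposition f : f \in Lfun P1 2%:E ->
  exists (F : bool -> T1 -> R) (E : bool -> T2 -> R),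
    (forall b, ge0_projection P1 q P2 (F b) (E b)) /\
    forall x, f x = F true x - F false x.
Proof.
move=> f2; pose F (b : bool) x := Num.max (if b then f x else - f x) 0.
have F2 b : F b \in Lfun P1 2%:E.
  apply: (le_Lfun2 _ _ f2).
    have mf := Lfun2_measurable f2; apply: measurable_maxr => //.
    by case: b => //; exact: measurableT_comp.
  move=> x; rewrite /F ger0_norm ?le_max ?lexx ?orbT// ge_max normr_ge0 andbT.
  by case: b; rewrite ?ler_norm// -normrN ler_norm.
have FE b : exists e, ge0_projection P1 q P2 (F b) e.
  by apply: ge0_projection_exists => // x; rewrite /F le_max lexx orbT.
exists F, (fun b => projT1 (cid (FE b))); split.
  by move=> b; case: (cid (FE b)).
move=> x; rewrite /F/=; have [f0|f0] := leP 0 (f x).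
  by rewrite max_r ?subr0// oppr_le0.
by rewrite max_l ?oppr_ge0 ?(ltW f0)// sub0r opprK.
Qed.

(** The two points are independent under the product measure, so conditioning a tensor square gives
    the tensor square of the conditional expectations. One family [E] has to serve both conclusions:
    the first controls its covariance, the second the cross term of the cost. *)
Lemma L2_projection_gauge n (F : 'I_n -> T1 -> R) :
  (forall k, F k \in Lfun P1 2%:E) -> exists E : 'I_n -> T2 -> R,
    (forall k, L2_projection P1 q P2 (F k) (E k)) /\
    forall a, L2_projection (P1 \x P1)%E q2 (P2 \x P2)%E
      (gauge_of a F) (gauge_of a E).
Proof.
move=> F2; have q22 := is_image_prod q12.
pose FF k := projT1 (cid (ge0_projection_decomposition (F2 k))).
pose EE k := projT1 (cid (projT2 (cid (ge0_projection_decomposition (F2 k))))).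
have FEE k b : ge0_projection P1 q P2 (FF k b) (EE k b).
  by rewrite /FF /EE; case: cid => /= F' ?; case: cid => /= E' [].
have FFE k x : F k x = FF k true x - FF k false x.
  by rewrite /FF; case: cid => /= F' [E' []].
pose E k y := EE k true y - EE k false y.
(* Signs that turn the difference of the parts [true] and [false] into a two-term sum, to which
   linearity of projections applies. A tensor square expands into four signed terms. *)
pose s (b : 'I_2) : R := (-1) ^+ b.
have sumE (u : bool -> R) : \sum_(b < 2) s b * u (b == ord0) = u true - u false.
  by rewrite !big_ord_recl big_ord0/= /s expr0 mul1r/= expr1 mulN1r addr0.
exists E; split.
  move=> k.
  have := L2_projection_sum q12 s
    (fun b : 'I_2 => ge0_projection_L2 (FEE k (b == ord0))).
  rewrite (_ : (fun x => _) = F k); last first.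
    by apply/funext => x; rewrite (sumE (fun b => FF k b x)) FFE.
  rewrite (_ : (fun x => _) = E k)//.
  by apply/funext => x; rewrite (sumE (fun b => EE k b x)).
move=> a; apply: (L2_projection_sum q22) => k.
have tens b c := ge0_projection_L2 (ge0_projection_tensor (FEE k b) (FEE k c)).
have tens1 b := L2_projection_sum q22 s (fun c : 'I_2 => tens b (c == ord0)).
have := L2_projection_sum q22 s (fun b : 'I_2 => tens1 (b == ord0)).
rewrite (_ : (fun x => _) = (fun z => F k z.1 * F k z.2)); last first.
  apply/funext => z.
  rewrite (sumE (fun b => \sum_(c < 2) s c * (FF k b z.1 * FF k (c == ord0) z.2))).
  rewrite !(sumE (fun c => FF k _ z.1 * FF k c z.2)) !FFE; ring.
rewrite (_ : (fun x => _) = (fun z => E k z.1 * E k z.2))//.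
apply/funext => z.
rewrite (sumE (fun b => \sum_(c < 2) s c * (EE k b z.1 * EE k (c == ord0) z.2))).
rewrite !(sumE (fun c => EE k _ z.1 * EE k c z.2)) /E; ring.
Qed.

End L2_projection_gauge.

(** * A trace inequality *)

Section rearrangement.
Variable R : realFieldType.

(** Summation by parts: the difference of the two sides combines the partial sums of [b - c] with
    the nonnegative decrements of [a]. The induction keeps the factor [a p] in front of the last
    partial sum, to be traded for the next one. *)
Lemma Abel_le (a b c : nat -> R) n :
  (forall k, 0 <= a k) -> (forall k, a k.+1 <= a k) ->
  (forall p, (p <= n)%N -> \sum_(k < p) c k <= \sum_(k < p) b k) ->
  \sum_(k < n) a k * c k <= \sum_(k < n) a k * b k.
Proof.
move=> a0 a_dec cb; case: n cb => [|n] cb; first by rewrite !big_ord0.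
rewrite -subr_ge0 -sumrB.
suff : forall p, (p <= n)%N ->
    a p * \sum_(k < p.+1) (b k - c k) <= \sum_(k < p.+1) (a k * b k - a k * c k).
  move=> /(_ n (leqnn n)); apply: le_trans.
  by rewrite mulr_ge0// sumrB subr_ge0 cb.
elim=> [_|p IH pn]; first by rewrite !big_ord_recr !big_ord0/= !add0r mulrBr.
rewrite big_ord_recr [leRHS]big_ord_recr/= mulrDr mulrBr lerD2r.
apply: (le_trans _ (IH (ltnW pn))); rewrite ler_wpM2r// sumrB subr_ge0.
by rewrite cb// (leq_trans pn).
Qed.

(** A decreasing nonnegative sequence is a positive combination of indicators of initial segments.
    Reducing [a] and then [b] to such indicators leaves the sum of [M] over a corner block of size
    [p] by [q], which is at most the smaller of the two sizes. *)
Lemma substochastic_le (M : nat -> nat -> R) (a b : nat -> R) n :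
  (forall k, 0 <= a k) -> (forall k, a k.+1 <= a k) ->
  (forall k, 0 <= b k) -> (forall k, b k.+1 <= b k) ->
  (forall k l, 0 <= M k l) ->
  (forall k, \sum_(l < n) M k l <= 1) -> (forall l, \sum_(k < n) M k l <= 1) ->
  \sum_(k < n) \sum_(l < n) a k * b l * M k l <= \sum_(k < n) a k * b k.
Proof.
move=> a0 a_dec b0 b_dec M0 row1 col1.
have sum_le (F : nat -> R) p q : (forall k, 0 <= F k) -> (p <= q)%N ->
    \sum_(k < p) F k <= \sum_(k < q) F k.
  move=> F0 pq; rewrite -(subnKC pq) big_split_ord/= lerDl sumr_ge0//.
under eq_bigr do under eq_bigr do rewrite -mulrA.
under eq_bigr do rewrite -mulr_sumr.
apply: (@Abel_le a b (fun k => \sum_(l < n) b l * M k l)) => // p pn.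
rewrite exchange_big/=.
under eq_bigr do rewrite -mulr_sumr.
rewrite (_ : \sum_(k < p) b k = \sum_(k < n) b k * (k < p)%N%:R); last first.
  rewrite (big_ord_widen _ b pn) big_mkcond/=; apply: eq_bigr => k _.
  by case: ifP; rewrite ?mulr1 ?mulr0.
(* Second summation by parts, now with weights [b]: the partial column sums of [M] are compared with
   the indicator of [k < p]. *)
apply: (@Abel_le b (fun k => (k < p)%N%:R) (fun l => \sum_(k < p) M k l)) => // q qn.
have -> : \sum_(k < q) (k < p)%N%:R = (minn p q)%:R :> R.
  under eq_bigr => k _ do rewrite -[_%:R]/((fun k => (k < p)%N%:R : R) (k : nat)).
  rewrite -(big_mkord xpredT (fun k => (k < p)%N%:R : R)) -natr_sum; congr _%:R.
  elim: q {qn} => [|q IH]; first by rewrite big_geq// minn0.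
  rewrite big_nat_recr//= IH; case: (ltnP q p) => qp.
    by rewrite addn1 !(minn_idPr _)// ltnW.
  by rewrite addn0 !(minn_idPl _)// ltnW.
(* The shorter side of the block decides whether rows or columns are summed. *)
have [pq|qp] := leqP p q.
  rewrite exchange_big/= -[leRHS]/(p%:R) -[p in p%:R]card_ord -sumr_const.
  apply: ler_sum => k _; apply: le_trans (row1 k); exact: sum_le.
rewrite -[leRHS]/(q%:R) -[q in q%:R]card_ord -sumr_const.
by apply: ler_sum => l _; apply: le_trans (col1 l); exact: (sum_le (fun k => M k l)).
Qed.

(** Zeros beyond the range put spectra of different dimensions on one index set; for nonnegative
    decreasing sequences, monotonicity survives. *)
Definition pad0 m (a : 'I_m -> R) (k : nat) : R := oapp a 0 (insub k).

Lemma pad0E m (a : 'I_m -> R) (k : 'I_m) : pad0 a k = a k.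
Proof. by rewrite /pad0 valK. Qed.

Lemma pad0_default m (a : 'I_m -> R) k : (m <= k)%N -> pad0 a k = 0.
Proof. by move=> mk; rewrite /pad0 insubN// -leqNgt. Qed.

Lemma pad0_ge0 m (a : 'I_m -> R) k : (forall i, 0 <= a i) -> 0 <= pad0 a k.
Proof. by move=> a0; rewrite /pad0; case: insub => /=. Qed.

Lemma pad0_decreasing m (a : 'I_m -> R) k : (forall i, 0 <= a i) ->
  (forall i j : 'I_m, (i <= j)%N -> a j <= a i) -> pad0 a k.+1 <= pad0 a k.
Proof.
move=> a0 a_dec; have [km|km] := ltnP k.+1 m; last first.
  by rewrite (pad0_default a km) pad0_ge0.
by rewrite -[k.+1]/(val (Ordinal km)) -[k]/(val (Ordinal (ltnW km))) !pad0E a_dec/=.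
Qed.

Lemma sum_pad0 m n (F : nat -> R) : (m <= n)%N ->
  (forall k, (m <= k)%N -> F k = 0) -> \sum_(k < n) F k = \sum_(k < m) F k.
Proof.
move=> mn F0; rewrite -(subnKC mn) big_split_ord/= [X in _ + X]big1 ?addr0// => k _.
by rewrite F0// leq_addr.
Qed.

(** The last hypothesis says that [C], rescaled by the inverse square roots of [a] and [b], has
    operator norm at most 1. Its rows and columns then have Euclidean norm at most 1, which is the
    substochasticity of the squared entries. *)
Lemma sum_sqr_bilinear_le m n p (C : 'I_m -> 'I_n -> R)
    (a : 'I_m -> R) (b : 'I_n -> R) :
  (m <= p)%N -> (n <= p)%N ->
  (forall k, 0 < a k) -> (forall k l : 'I_m, (k <= l)%N -> a l <= a k) ->
  (forall k, 0 < b k) -> (forall k l : 'I_n, (k <= l)%N -> b l <= b k) ->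
  (forall u v, (\sum_k \sum_l u k * v l * C k l) ^+ 2 <=
     (\sum_k a k * u k ^+ 2) * (\sum_l b l * v l ^+ 2)) ->
  \sum_k \sum_l C k l ^+ 2 <= \sum_(k < p) pad0 a k * pad0 b k.
Proof.
move=> mp np a0 a_dec b0 b_dec H.
have a_ge0 k : 0 <= a k by exact: ltW.
have b_ge0 k : 0 <= b k by exact: ltW.
(* [C k l ^+ 2 / (a k * b l)] is doubly substochastic: test the bilinear bound on
   a basis vector and on the corresponding row or column of [C]. *)
have row k : \sum_l C k l ^+ 2 / (a k * b l) <= 1.
  pose s := \sum_l C k l ^+ 2 / b l.
  have s0 : 0 <= s by apply: sumr_ge0 => l _; rewrite divr_ge0 ?sqr_ge0.
  have := H (fun i => (i == k)%:R) (fun l => C k l / b l).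
  rewrite (bigD1 k)//= [X in _ + X]big1 ?addr0; last first.
    by move=> i /negPf ik; apply: big1 => l _; rewrite ik !mul0r.
  rewrite [X in X * _](bigD1 k)//= [X in _ + X]big1 ?addr0; last first.
    by move=> i /negPf ik; rewrite ik expr0n mulr0.
  rewrite eqxx expr1n mulr1.
  have -> : \sum_l 1 * (C k l / b l) * C k l = s.
    by apply: eq_bigr => l _; rewrite mul1r mulrAC expr2.
  have -> : \sum_l b l * (C k l / b l) ^+ 2 = s.
    by apply: eq_bigr => l _; field; rewrite gt_eqF.
  have -> : \sum_l C k l ^+ 2 / (a k * b l) = s / a k.
    by rewrite /s mulr_suml; apply: eq_bigr => l _; rewrite invfM mulrA mulrAC.
  have [->|s_neq0] := eqVneq s 0; first by move=> _; rewrite mul0r ler01.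
  rewrite expr2 ler_pM2r ?lt_neqAle 1?eq_sym ?s_neq0// => sa.
  by rewrite ler_pdivrMr ?mul1r.
have col l : \sum_k C k l ^+ 2 / (a k * b l) <= 1.
  pose s := \sum_k C k l ^+ 2 / a k.
  have s0 : 0 <= s by apply: sumr_ge0 => k _; rewrite divr_ge0 ?sqr_ge0.
  have := H (fun k => C k l / a k) (fun i => (i == l)%:R).
  rewrite exchange_big (bigD1 l)//= [X in _ + X]big1 ?addr0; last first.
    by move=> i /negPf il; apply: big1 => k _; rewrite il mulr0 mul0r.
  rewrite [X in _ * X](bigD1 l)//= [X in _ * (_ + X)]big1 ?addr0; last first.
    by move=> i /negPf il; rewrite il expr0n mulr0.
  rewrite eqxx expr1n mulr1.
  have -> : \sum_k C k l / a k * 1 * C k l = s.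
    by apply: eq_bigr => k _; rewrite mulr1 mulrAC expr2.
  have -> : \sum_k a k * (C k l / a k) ^+ 2 = s.
    by apply: eq_bigr => k _; field; rewrite gt_eqF.
  have -> : \sum_k C k l ^+ 2 / (a k * b l) = s / b l.
    by rewrite /s mulr_suml; apply: eq_bigr => k _; rewrite invfM mulrA.
  have [->|s_neq0] := eqVneq s 0; first by move=> _; rewrite mul0r ler01.
  rewrite expr2 ler_pM2l ?lt_neqAle 1?eq_sym ?s_neq0// => sb.
  by rewrite ler_pdivrMr ?mul1r.
pose M k l := pad0 (fun i => pad0 (fun j => C i j ^+ 2 / (a i * b j)) l) k.
have ME (k : 'I_m) (l : 'I_n) : M k l = C k l ^+ 2 / (a k * b l).
  by rewrite /M !pad0E.
have M0 k l : 0 <= M k l.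
  by apply: pad0_ge0 => i; apply: pad0_ge0 => j; rewrite divr_ge0 ?sqr_ge0 ?mulr_ge0.
have Mm k l : (m <= k)%N -> M k l = 0 by exact: pad0_default.
have Mn k l : (n <= l)%N -> M k l = 0.
  by move=> nl; rewrite /M {1}/pad0; case: insub => //= i; exact: pad0_default.
have rowM k : \sum_(l < p) M k l <= 1.
  have [mk|km] := leqP m k; first by rewrite big1 ?ler01// => l _; exact: Mm.
  rewrite (sum_pad0 np (fun l => @Mn k l)); apply: le_trans (row (Ordinal km)).
  by rewrite le_eqVlt; apply/orP/or_introl/eqP/eq_bigr => l _; rewrite -ME.
have colM l : \sum_(k < p) M k l <= 1.
  have [nl|ln] := leqP n l; first by rewrite big1 ?ler01// => k _; exact: Mn.
  rewrite (sum_pad0 (F := M^~ l) mp (fun k => @Mm k l)).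
  apply: le_trans (col (Ordinal ln)).
  by rewrite le_eqVlt; apply/orP/or_introl/eqP/eq_bigr => k _; rewrite -ME.
apply: le_trans (substochastic_le _ _ _ _ M0 rowM colM); last 4 first.
- by move=> k; exact: pad0_ge0.
- by move=> k; exact: pad0_decreasing.
- by move=> k; exact: pad0_ge0.
- by move=> k; exact: pad0_decreasing.
rewrite (sum_pad0 (F := fun k => \sum_(l < p) pad0 a k * pad0 b l * M k l) mp); last first.
  by move=> k mk; apply: big1 => l _; rewrite Mm// mulr0.
apply: ler_sum => k _.
rewrite (sum_pad0 (F := fun l => pad0 a k * pad0 b l * M k l) np); last first.
  by move=> l nl; rewrite Mn// mulr0.
apply: ler_sum => l _; rewrite !pad0E ME mulrC divfK// gt_eqF// mulr_gt0//.
Qed.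

End rearrangement.

(** * The Cramer-Wold theorem *)

Section step.
Variable R : realType.

(* Tends to [1] for [s > 0] and to [0] for [s < 0]; being a polynomial in [s], it
   is a trigonometric polynomial when [s] is the sine of a linear form. *)
Definition soft_step n (s : R) : R := (1 - ((1 - s) / 2) ^+ n) ^+ (2 ^ n).

Lemma expr_ge1Dn (x : R) n : -1 <= x -> 1 + n%:R * x <= (1 + x) ^+ n.
Proof.
move=> x1; elim: n => [|n IH]; first by rewrite mul0r addr0 expr0.
rewrite exprS; apply: (@le_trans _ _ ((1 + x) * (1 + n%:R * x))); last first.
  by rewrite ler_wpM2l// -lerBlDl sub0r.
rewrite -subr_ge0 -natr1.
have -> : (1 + x) * (1 + n%:R * x) - (1 + (n%:R + 1) * x) = n%:R * x ^+ 2 by ring.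
by rewrite mulr_ge0// sqr_ge0.
Qed.

Lemma soft_step_itv n s : `|s| <= 1 -> 0 <= soft_step n s <= 1.
Proof.
rewrite ler_norml => /andP[s1 s2].
have w0 : 0 <= (1 - s) / 2 by lra.
have w1 : (1 - s) / 2 <= 1 by lra.
by rewrite exprn_ge0 ?exprn_ile1// ?subr_ge0 ?exprn_ile1// gerBl exprn_ge0.
Qed.

(** With [w = (1 - s) / 2], Bernoulli's inequality gives [1 - (2 * w) ^+ n] as a lower bound. The
    outer exponent [2 ^ n] thus places the threshold at [w = 1 / 2], that is, at [s = 0]. *)
Lemma soft_step_gt0 s : 0 < s <= 1 -> soft_step n s @[n --> \oo] --> (1 : R).
Proof.
move=> /andP[s0 s1].
have sn n : 0 <= soft_step n s <= 1 by apply: soft_step_itv; rewrite gtr0_norm.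
apply: (@squeeze_cvgr _ _ _ _ (fun n => 1 - (1 - s) ^+ n) (fun=> 1)).
- apply: nearW => n; apply/andP; split; last first.
    by case/andP: (sn n).
  have := @expr_ge1Dn (- ((1 - s) / 2) ^+ n) (2 ^ n).
  rewrite lerN2 exprn_ile1 => [/(_ isT)||]; [|lra|lra].
  by apply: le_trans; rewrite mulrN expr_div_n natrX mulrCA divff ?mulr1// expf_neq0.
- rewrite -[X in _ --> X]subr0; apply: cvgB; first exact: cvg_cst.
  by apply: cvg_expr; rewrite ger0_norm; lra.
- exact: cvg_cst.
Qed.

(** Multiplying by [(1 + w ^+ n) ^+ (2 ^ n)] gives at most 1, while Bernoulli bounds that factor
    below by [(2 * w) ^+ n = (1 - s) ^+ n], which diverges. *)
Lemma soft_step_lt0 s : -1 <= s < 0 -> soft_step n s @[n --> \oo] --> (0 : R).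
Proof.
move=> /andP[s1 s0].
have sn n : 0 <= soft_step n s <= 1.
  by apply: soft_step_itv; rewrite ltr0_norm// lerNl.
apply: (@squeeze_cvgr _ _ _ _ (fun=> 0) (fun n => ((1 - s)^-1) ^+ n)).
- apply: nearW => n; apply/andP; split.
    by case/andP: (sn n).
  have s2 : 0 < 1 - s by lra.
  rewrite exprVn -[leRHS]mul1r ler_pdivlMr ?exprn_gt0//.
  set w := (1 - s) / 2; have -> : 1 - s = 2 * w by rewrite /w; lra.
  have w0 : 0 <= w by rewrite /w; lra.
  have w1 : w <= 1 by rewrite /w; lra.
  have wn0 : 0 <= w ^+ n by rewrite exprn_ge0.
  have wn1 : w ^+ n <= 1 by rewrite exprn_ile1.
  apply: (@le_trans _ _ (soft_step n s * (1 + w ^+ n) ^+ (2 ^ n))).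
    apply: ler_wpM2l.
      by case/andP: (sn n).
    rewrite exprMn -natrX; apply: (le_trans _ (@expr_ge1Dn (w ^+ n) (2 ^ n) _)).
      by rewrite lerDr.
    by rewrite (le_trans _ wn0)// oppr_le0.
  rewrite /soft_step -/w -exprMn.
  have -> : (1 - w ^+ n) * (1 + w ^+ n) = 1 - (w ^+ n) ^+ 2 by ring.
  by rewrite exprn_ile1// ?subr_ge0 ?exprn_ile1// gerBl exprn_ge0.
- exact: cvg_cst.
- by apply: cvg_expr; rewrite ger0_norm ?invr_ge0 ?invf_lt1; lra.
Qed.

(** Monotone and bounded: with [h = (1 / 2) ^+ n], the increase from [n] to [n.+1] comes from
    [1 - h <= (1 - h / 2) ^+ 2]. *)
Lemma is_cvg_soft_step0 : cvgn (soft_step ^~ 0).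
Proof.
apply: nondecreasing_is_cvgn; last first.
  exists 1 => _ [n _ <-].
  have : 0 <= soft_step n 0 <= 1 by apply: soft_step_itv; rewrite normr0.
  by case/andP.
apply/nondecreasing_seqP => n; rewrite /soft_step subr0 expnS mulnC.
rewrite mulnC exprM lerXn2r ?nnegrE//.
- by rewrite subr_ge0 exprn_ile1//; lra.
- by rewrite sqr_ge0.
- rewrite [_ ^+ n.+1]exprS; set h := (1 / 2) ^+ n.
  by rewrite -subr_ge0; have := sqr_ge0 h; lra.
Qed.

(* The value at [0] is irrelevant: it disappears in the limit where the
   threshold is approached from below. *)
Definition step (s : R) : R :=
  if 0 < s then 1 else if s == 0 then limn (soft_step ^~ 0) else 0.

Lemma cvg_soft_step s : `|s| <= 1 -> soft_step n s @[n --> \oo] --> step s.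
Proof.
rewrite ler_norml /step => /andP[s1 s2]; have [s0|s0|s0] := ltgtP s 0.
- by apply: soft_step_lt0; rewrite s1.
- by apply: soft_step_gt0; rewrite s0.
- by rewrite s0; exact: is_cvg_soft_step0.
Qed.

Lemma step_itv s : `|step s| <= 1.
Proof.
rewrite /step; case: ifP => _; first by rewrite normr1.
case: ifP => _; last by rewrite normr0.
have L n : 0 <= soft_step n 0 <= 1 by apply: soft_step_itv; rewrite normr0.
rewrite ger0_norm; [apply: limr_le|apply: limr_ge]; try exact: is_cvg_soft_step0.
  by apply: nearW => n; case/andP: (L n).
by apply: nearW => n; case/andP: (L n).
Qed.

(** The dilation eventually brings [y] between [- pi] and [pi], where the sine has the sign of its
    argument; the sequence is constant from then on. *)
Lemma cvg_step_sin (y : R) : step (sin (j.+1%:R^-1 * y)) @[j --> \oo] --> step y.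
Proof.
apply: cvg_near_cst; near=> j.
have t0 : (0 : R) < j.+1%:R^-1 by rewrite invr_gt0.
have yj : `|j.+1%:R^-1 * y| < pi.
  rewrite normrM gtr0_norm// mulrC ltr_pdivrMr//.
  apply: (@lt_le_trans _ _ (pi * (`|y| / pi + 1))).
    by rewrite mulrDr mulr1 mulrC divfK ?gt_eqF ?pi_gt0// ltrDl pi_gt0.
  rewrite ler_pM2l ?pi_gt0// -natr1 lerD2r.
  by near: j; exact: nbhs_infty_ger.
move: yj; rewrite ltr_norml => /andP[yj1 yj2].
rewrite /step; have [y0|y0|->] := ltgtP y 0.
- have ty : j.+1%:R^-1 * y < 0 by rewrite pmulr_rlt0.
  have : 0 < sin (- (j.+1%:R^-1 * y)) by apply: sin_gt0_pi; rewrite oppr_gt0 ty ltrNl.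
  by rewrite sinN oppr_gt0 => s0; rewrite ltNge ltW//= lt_eqF.
- by rewrite sin_gt0_pi// yj2 andbT pmulr_rgt0.
- by rewrite mulr0 sin0 eqxx ltxx.
Unshelve. all: by end_near. Qed.

Lemma cvg_step_shift (y : R) :
  step (y + j.+1%:R^-1) @[j --> \oo] --> ((0 <= y)%R%:R : R).
Proof.
apply: cvg_near_cst; near=> j; rewrite /step.
have t0 : (0 : R) < j.+1%:R^-1 by rewrite invr_gt0.
have [y0|y0] := leP 0 y; first by rewrite ltr_wpDl.
have yj : y + j.+1%:R^-1 < 0.
  rewrite -ltrBrDl sub0r invf_plt ?posrE ?oppr_gt0// -natr1.
  rewrite (@lt_le_trans _ _ ((- y)^-1 + 1)) ?ltrDl// lerD2r.
  by near: j; exact: nbhs_infty_ger.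
by rewrite ltNge ltW//= lt_eqF.
Unshelve. all: by end_near. Qed.

End step.

Section cramer_wold.
Context d (T : measurableType d) (R : realType) (P1 P2 : probability T R).
Variable L : set (T -> R).
Hypotheses (L_measurable : forall l, L l -> measurable_fun setT l)
  (L_lin : forall a b l l', L l -> L l' -> L (fun x => a * l x + b * l' x))
  (L0 : L (fun=> 0))
  (L_law : forall l, L l -> forall B, measurable B ->
     P1 (l @^-1` B) = P2 (l @^-1` B)).

(* By the product-to-sum formulas this class is stable under multiplication by
   cosines of elements of [L], hence by bounded limits of polynomials in them,
   hence by indicators of half-spaces. *)
Definition cos_indiscernible (f : T -> R) :=
  [/\ measurable_fun setT f, exists M, forall x, `|f x| <= M &
    forall l c, L l -> \int[P1]_x (f x * cos (l x + c)) =
                       \int[P2]_x (f x * cos (l x + c))].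

Let bounded_integrable (P : probability T R) (f : T -> R) M : measurable_fun setT f ->
  (forall x, `|f x| <= M) -> P.-integrable setT (EFin \o f).
Proof.
move=> mf fM; apply: (@le_integrable _ _ _ P _ measurableT _ (cst M%:E)).
- exact/measurable_EFinP.
- move=> x _; rewrite /= lee_fin; apply: le_trans (fM x) _; exact: ler_norm.
- exact: finite_measure_integrable_cst.
Qed.

Let measurable_cos : measurable_fun setT (@cos R).
Proof. by apply: continuous_measurable_fun; exact: continuous_cos. Qed.

Let measurable_cos_lin l c : L l -> measurable_fun setT (fun x => cos (l x + c)).
Proof.
move=> Ll; apply: (measurableT_comp measurable_cos).
by apply: measurable_funD => //; exact: L_measurable.
Qed.

Let cos_integrable (P : probability T R) f l c : cos_indiscernible f -> L l ->
  P.-integrable setT (EFin \o (fun x => f x * cos (l x + c))).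
Proof.
move=> [mf [M fM] _] Ll; apply: (@bounded_integrable _ _ M).
  by apply: measurable_funM => //; exact: measurable_cos_lin.
move=> x; rewrite normrM (le_trans _ (fM x))// ler_piMr//; exact: cos_max.
Qed.

(** The base case, and the point where equality of the one-dimensional laws enters. *)
Lemma cos_indiscernible1 : cos_indiscernible (fun=> 1).
Proof.
split=> //; first by exists 1 => x; rewrite normr1.
move=> l c Ll; have ml := L_measurable Ll.
have P1l : is_image P1 l (pushforward P1 l) by split.
have P2l : is_image P2 l (pushforward P1 l).
  by split=> // B mB; rewrite /= /pushforward -L_law.
have mc : measurable_fun setT (fun t : R => cos (t + c)).
  by apply: (measurableT_comp measurable_cos); exact: measurable_funD.
under eq_Rintegral do rewrite mul1r; under [RHS]eq_Rintegral do rewrite mul1r.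
by rewrite -(Rintegral_image (P1l ml) mc) -(Rintegral_image (P2l ml) mc).
Qed.

Lemma cos_indiscernible_lin a b f g : cos_indiscernible f ->
  cos_indiscernible g -> cos_indiscernible (fun x => a * f x + b * g x).
Proof.
move=> Kf Kg; have [mf [M fM] fE] := Kf; have [mg [N gN] gE] := Kg; split.
- by apply: measurable_funD; apply: measurable_funM.
- exists (`|a| * M + `|b| * N) => x.
  by rewrite (le_trans (ler_normD _ _))// !normrM lerD// ler_wpM2l.
- move=> l c Ll.
  have E (P : probability T R) :
      \int[P]_x ((a * f x + b * g x) * cos (l x + c)) =
      a * \int[P]_x (f x * cos (l x + c)) + b * \int[P]_x (g x * cos (l x + c)).
    have fi := cos_integrable P c Kf Ll; have gi := cos_integrable P c Kg Ll.
    rewrite -!RintegralZl// -RintegralD//.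
    - by apply: eq_Rintegral => x _; ring.
    - by have := integrableZl measurableT a fi.
    - by have := integrableZl measurableT b gi.
  by rewrite !E fE// gE.
Qed.

Lemma cos_indiscernibleM f l c : cos_indiscernible f -> L l ->
  cos_indiscernible (fun x => f x * cos (l x + c)).
Proof.
move=> Kf Ll; have [mf [M fM] fE] := Kf; split.
- by apply: measurable_funM => //; exact: measurable_cos_lin.
- exists M => x; rewrite normrM (le_trans _ (fM x))// ler_piMr//; exact: cos_max.
- move=> l' c' Ll'.
  have Lp : L (fun x => 1 * l x + 1 * l' x) by exact: L_lin.
  have Lm : L (fun x => 1 * l x + (-1) * l' x) by exact: L_lin.
  have E (P : probability T R) :
      \int[P]_x (f x * cos (l x + c) * cos (l' x + c')) =
      2^-1 * \int[P]_x (f x * cos (1 * l x + 1 * l' x + (c + c'))) +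
      2^-1 * \int[P]_x (f x * cos (1 * l x + (-1) * l' x + (c - c'))).
    have ip := cos_integrable P (c + c') Kf Lp.
    have im := cos_integrable P (c - c') Kf Lm.
    rewrite -!RintegralZl// -RintegralD//.
    - apply: eq_Rintegral => x _.
      have -> : 1 * l x + 1 * l' x + (c + c') = (l x + c) + (l' x + c') by ring.
      have -> : 1 * l x + -1 * l' x + (c - c') = (l x + c) - (l' x + c') by ring.
      by move: (l x + c) (l' x + c') => s t; rewrite cosD cosB; field.
    - by have := integrableZl measurableT 2^-1 ip.
    - by have := integrableZl measurableT 2^-1 im.
  by rewrite !E !fE.
Qed.

Lemma cos_indiscernible_lim (h : nat -> T -> R) f M :
  (forall n, cos_indiscernible (h n)) -> (forall n x, `|h n x| <= M) ->
  (forall x, h n x @[n --> \oo] --> f x) -> cos_indiscernible f.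
Proof.
move=> Kh hM hf.
have mf : measurable_fun setT f.
  by apply: (measurable_fun_cvg (h := h)) => // n; case: (Kh n).
have fM x : `|f x| <= M.
  have hn : `|h n x| @[n --> \oo] --> `|f x| by apply: cvg_norm; exact: hf.
  rewrite -(cvg_lim _ hn)//; apply: limr_le; first by apply/cvg_ex; exists `|f x|.
  by apply: nearW => n; exact: hM.
split=> //; first by exists M.
move=> l c Ll.
have cvg_int (P : probability T R) :
    (\int[P]_x (h n x * cos (l x + c))%:E @[n --> \oo] -->
     \int[P]_x (f x * cos (l x + c))%:E)%E.
  have M0 : 0 <= M.
    by apply: le_trans (fM point).
  have [] := @dominated_convergence _ _ _ P setT measurableT
    (fun n x => (h n x * cos (l x + c))%:E) (fun x => (f x * cos (l x + c))%:E)
    (cst M%:E) => //.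
  - move=> n; apply/measurable_EFinP; apply: measurable_funM; first by case: (Kh n).
    exact: measurable_cos_lin.
  - by apply/measurable_EFinP; apply: measurable_funM => //; exact: measurable_cos_lin.
  - apply: aeW => x _; apply: cvg_EFin; first by apply: nearW.
    by apply: cvgMr_tmp; exact: hf.
  - exact: finite_measure_integrable_cst.
  - apply: aeW => x n _; rewrite /= lee_fin normrM -[leRHS]mulr1 ler_pM//.
    exact: cos_max.
rewrite /Rintegral; congr fine.
rewrite -(cvg_lim _ (cvg_int P1))// -(cvg_lim _ (cvg_int P2))//.
congr (limn _); apply/funext => n.
have fin P := integrable_fin_num measurableT (cos_integrable P c (Kh n) Ll).
rewrite -[LHS](fineK (fin P1)) -[RHS](fineK (fin P2)); congr EFin.
by have [_ _ hE] := Kh n; exact: hE.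
Qed.

Lemma cos_indiscernible_step f l c : cos_indiscernible f -> L l ->
  cos_indiscernible (fun x => f x * step (sin (l x + c))).
Proof.
move=> Kf Ll; have [mf [M fM] _] := Kf.
pose w x := (1 - sin (l x + c)) / 2.
have Kw g : cos_indiscernible g -> cos_indiscernible (fun x => g x * w x).
  (* The phase [c - pi / 2] turns the cosine into the sine, which makes multiplication by [w]
     available; [soft_step] is a polynomial in [w]. *)
  move=> Kg; have := cos_indiscernible_lin (2^-1) (- 2^-1) Kg
    (cos_indiscernibleM (c - pi / 2) Kg Ll).
  congr cos_indiscernible; apply/funext => x.
  by rewrite addrA cosBpihalf /w; field.
have Kwn n g : cos_indiscernible g -> cos_indiscernible (fun x => g x * w x ^+ n).
  move=> Kg; elim: n => [|n IH].
    by under [X in cos_indiscernible X]eq_fun do rewrite mulr1.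
  by under [X in cos_indiscernible X]eq_fun do rewrite exprSr mulrA; exact: Kw.
have K1w n m g : cos_indiscernible g ->
    cos_indiscernible (fun x => g x * (1 - w x ^+ n) ^+ m).
  move=> Kg; elim: m => [|m IH].
    by under [X in cos_indiscernible X]eq_fun do rewrite mulr1.
  have := cos_indiscernible_lin 1 (-1) IH (Kwn n _ IH).
  by congr cos_indiscernible; apply/funext => x; rewrite exprSr; ring.
have sin1 x : `|sin (l x + c)| <= 1 by exact: sin_max.
apply: (@cos_indiscernible_lim (fun n x => f x * soft_step n (sin (l x + c))) _ M).
- by move=> n; exact: K1w.
- move=> n x; rewrite normrM (le_trans _ (fM x))// ler_piMr//.
  by have /andP[s0 s1] := soft_step_itv n (sin1 x); rewrite ger0_norm.
- by move=> x; apply: cvgMl_tmp; exact: cvg_soft_step.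
Qed.

(** Two successive limits: sines of dilated forms give the step at any threshold [b], and letting
    [b] increase to [a] includes the boundary hyperplane. *)
Lemma cos_indiscernible_ge f l a : cos_indiscernible f -> L l ->
  cos_indiscernible (fun x => f x * (a <= l x)%R%:R).
Proof.
move=> Kf Ll; have [mf [M fM] _] := Kf.
have Kstep b : cos_indiscernible (fun x => f x * step (l x - b)).
  apply: (@cos_indiscernible_lim
      (fun j x => f x * step (sin (j.+1%:R^-1 * (l x - b)))) _ M).
  - move=> j.
    have Lj : L (fun x => j.+1%:R^-1 * l x + 0 * 0) by exact: L_lin.
    have := cos_indiscernible_step (- (j.+1%:R^-1 * b)) Kf Lj.
    congr cos_indiscernible; apply/funext => x; congr (_ * step (sin _)).
    by rewrite mulrBr mul0r addr0.
  - move=> n x; rewrite normrM (le_trans _ (fM x))// ler_piMr//; exact: step_itv.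
  - by move=> x; apply: cvgMl_tmp; exact: cvg_step_sin.
apply: (@cos_indiscernible_lim
    (fun j x => f x * step (l x - a + j.+1%:R^-1)) _ M).
- move=> j; have := Kstep (a - j.+1%:R^-1).
  by congr cos_indiscernible; apply/funext => x; rewrite opprB addrA addrAC.
- move=> n x; rewrite normrM (le_trans _ (fM x))// ler_piMr//; exact: step_itv.
- move=> x; apply: cvgMl_tmp; rewrite -subr_ge0; exact: cvg_step_shift.
Qed.

(** Multiplications by indicators compose, so this class is closed under intersections, which the
    mere equality of [P1] and [P2] on a set would not give. It is therefore a sigma-algebra. *)
Definition stable_set : set (set T) := [set A | measurable A /\
  forall f, cos_indiscernible f -> cos_indiscernible (fun x => f x * \1_A x)].

Lemma stable_set_half_space l a : L l -> stable_set [set x | a <= l x].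
Proof.
move=> Ll; split.
  rewrite (_ : [set _ | _] = setT `&` l @^-1` `[a, +oo[); last first.
    by rewrite setTI; apply/seteqP; split=> x /=; rewrite in_itv/= andbT.
  exact: L_measurable.
move=> f Kf; have := cos_indiscernible_ge a Kf Ll.
congr cos_indiscernible; apply/funext => x; rewrite indicE.
by congr (_ * (nat_of_bool _)%:R); apply/idP/idP; rewrite inE.
Qed.

Lemma stable_set_sigma_algebra : sigma_algebra setT stable_set.
Proof.
have SC A : stable_set A -> stable_set (~` A).
  move=> [mA KA]; split; first exact: measurableC.
  move=> f Kf; have := cos_indiscernible_lin 1 (-1) Kf (KA f Kf).
  congr cos_indiscernible; apply/funext => x.
  by rewrite !indicE in_setC; case: (x \in A) => /=; ring.
have SI A B : stable_set A -> stable_set B -> stable_set (A `&` B).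
  move=> [mA KA] [mB KB]; split; first exact: measurableI.
  move=> f Kf; have := KB _ (KA _ Kf).
  by congr cos_indiscernible; apply/funext => x; rewrite indicI mulrA.
have ST : stable_set setT.
  split=> // f Kf; rewrite (_ : (fun x => _) = f)//.
  by apply/funext => x; rewrite indicT mulr1.
split.
- by rewrite -setCT; exact: SC.
- by move=> A; rewrite setTD; exact: SC.
- move=> A SA; pose B n := \bigcup_(k < n) A k.
  have SB n : stable_set (B n).
    rewrite /B bigcup_mkord -[X in stable_set X]setCK setC_bigsetU.
    by apply: (SC); elim/big_ind: _ => // k _; exact: (SC _ (SA k)).
  split; first by apply: bigcup_measurable => k _; case: (SA k).
  move=> f Kf; have [_ [M fM] _] := Kf.
  apply: (@cos_indiscernible_lim (fun n x => f x * \1_(B n) x) _ M).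
  + by move=> n; exact: (SB n).2.
  + move=> n x; rewrite normrM (le_trans _ (fM x))// ler_piMr// indicE.
    by case: (_ \in _); rewrite ?normr1 ?normr0.
  + move=> x; apply: cvgMl_tmp; apply: cvg_near_cst; rewrite !indicE.
    have [[k _ Akx]|nA] := pselect ((\bigcup_k A k) x).
      rewrite (@mem_set _ (\bigcup_k A k)); last by exists k.
      near=> n; rewrite indicE mem_set//; exists k => //=.
      by near: n; exact: nbhs_infty_gt.
    rewrite (memNset nA); near=> n; rewrite indicE memNset//.
    by move=> [k _ Akx]; apply: nA; exists k.
Unshelve. all: by end_near. Qed.

Theorem cramer_wold A : <<s [set H | exists l a, L l /\ H = [set x | a <= l x]] >> A ->
  P1 A = P2 A.
Proof.
move=> sA; have [mA KA] : stable_set A.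
  apply: sA; split; first exact: stable_set_sigma_algebra.
  by move=> _ [l [a [Ll ->]]]; exact: stable_set_half_space.
have [_ _ /(_ (fun=> 0) 0 L0)] := KA _ cos_indiscernible1.
rewrite addr0 cos0 => E.
have F (P : probability T R) :
    P A = (\int[P]_x (1 * \1_A x * 1))%:E.
  under eq_Rintegral do rewrite mul1r mulr1.
  by rewrite /Rintegral integral_indic// setIT fineK// fin_num_measure.
by rewrite !F E.
Qed.

End cramer_wold.

Lemma continuous_borel_measurable (T U : ptopologicalType) (f : T -> U) :
  continuous f -> measurable_fun setT (f : borel T -> borel U).
Proof.
move=> cf.
apply: (@measurability _ _ (borel T) (borel U) setT f (@open U)) => // _ [B oB <-].
by rewrite setTI; apply: sub_sigma_algebra; move/continuousP : cf; exact.
Qed.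

Lemma continuous_borel_measurableR (R : realType) (T : ptopologicalType)
  (f : T -> R) : continuous f -> measurable_fun setT (f : borel T -> R).
Proof.
move=> cf; apply: (measurability _ (RGenOpens.measurableE R)) => _ [_ [a [b ->]] <-].
rewrite setTI; apply: sub_sigma_algebra; move/continuousP : cf; apply.
exact: interval_open.
Qed.

(** * Topology and Borel sets of column vectors *)

Section column_vectors.
Variables (R : realType) (n : nat).
Implicit Types u v x y : 'cV[R]_n.

Lemma dotvC u v : dotv u v = dotv v u.
Proof. by apply: eq_bigr => k _; rewrite mulrC. Qed.

Lemma dotvDl u v x : dotv (u + v) x = dotv u x + dotv v x.
Proof. by rewrite /dotv -big_split; apply: eq_bigr => k _; rewrite mxE mulrDl. Qed.

Lemma dotvZl a u x : dotv (a *: u) x = a * dotv u x.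
Proof. by rewrite /dotv mulr_sumr; apply: eq_bigr => k _; rewrite mxE mulrA. Qed.

Lemma dotvNl u x : dotv (- u) x = - dotv u x.
Proof. by rewrite -scaleN1r dotvZl mulN1r. Qed.

Lemma dotv_delta k x : dotv (delta_mx k 0) x = x k 0.
Proof.
rewrite /dotv (bigD1 k)//= big1 ?addr0 ?mxE ?eqxx ?mul1r// => l lk.
by rewrite mxE (negPf lk) mul0r.
Qed.

Lemma continuous_dotv u : continuous (dotv u).
Proof.
pose S (s : seq 'I_n) x := \sum_(k <- s) u k 0 * x k 0.
suff cS s : continuous (S s) by exact: cS.
elim: s => [|k s IH].
  rewrite (_ : S [::] = cst 0); first exact: cst_continuous.
  by apply/funext => x; rewrite /S big_nil.
rewrite (_ : S (k :: s) = fun x => u k 0 * x k 0 + S s x); last first.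
  by apply/funext => x; rewrite /S big_cons.
have cu : continuous (fun x : 'cV[R]_n => u k 0 * x k 0).
  move=> x; apply: continuousM; first exact: cst_continuous.
  exact: coord_continuous.
by move=> x; exact: (@cvgD _ R^o _ _ _ _ _ _ _ (cu x) (IH x)).
Qed.

Lemma measurable_dotv u : measurable_fun setT (dotv u : borel 'cV[R]_n -> R).
Proof. by apply: continuous_borel_measurableR; exact: continuous_dotv. Qed.

Lemma mulmx_dotv m (M : 'M[R]_(m, n)) x i : (M *m x) i 0 = dotv (row i M)^T x.
Proof. by rewrite mxE; apply: eq_bigr => k _; rewrite !mxE. Qed.

Lemma continuous_mulmx m (M : 'M[R]_(m, n)) :
  continuous (mulmx M : 'cV[R]_n -> 'cV[R]_m).
Proof.
move=> x A [Q Qx QA].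
have Qi (i : 'I_m) : \forall y \near x, Q i 0 ((M *m y) i 0).
  have Qxi : nbhs (dotv (row i M)^T x) (Q i 0) by rewrite -mulmx_dotv.
  have nx : nbhs x (dotv (row i M)^T @^-1` Q i 0) by exact: (continuous_dotv Qxi).
  by apply: filterS nx => y; rewrite /= -mulmx_dotv.
have nx : \forall y \near x, forall i, Q i 0 ((M *m y) i 0) by exact: (filter_forall _ Qi).
by apply: filterS nx => y Qy; apply: QA => i j; rewrite ord1.
Qed.

Definition half_spaces : set (set 'cV[R]_n) :=
  [set H | exists l a, range (@dotv R n) l /\ H = [set x | a <= l x]].

(** Cubes with rational data form a countable family; they yield both separability and the
    decomposition of open sets. *)
Let rational_ball (i : 'cV[rat]_n * rat) : set 'cV[R]_n :=
  [set x | forall k, `|ratr (i.1 k 0) - x k 0| < ratr i.2].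

Lemma rational_point x (e : R) : 0 < e ->
  exists c : 'cV[rat]_n, forall k, `|ratr (c k 0) - x k 0| < e.
Proof.
move=> e0.
have /choice[f fP] : forall k, exists q : rat, `|ratr q - x k 0| < e.
  move=> k; have : x k 0 < x k 0 + e by rewrite ltrDl.
  move=> /rat_in_itvoo[q]; rewrite in_itv/= => /andP[q1 q2]; exists q.
  by rewrite ger0_norm ?ltrBlDl// subr_ge0 ltW.
by exists (\col_k f k) => k; rewrite mxE.
Qed.

Lemma rational_ball_nbhs x (A : set 'cV[R]_n) : nbhs x A ->
  exists i, rational_ball i x /\ rational_ball i `<=` A.
Proof.
move=> /nbhs_ballP[e /= e0 eA].
have : 0 < e / 2 by rewrite divr_gt0.
move=> /rat_in_itvoo[r]; rewrite in_itv/= => /andP[r0 re].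
have [c cP] := rational_point x r0; exists (c, r); split => //.
move=> y yB; apply: eA; split=> // k j; rewrite ord1 /ball/=.
rewrite (_ : x k 0 - y k 0 = (ratr (c k 0) - y k 0) - (ratr (c k 0) - x k 0)); last by ring.
rewrite (le_lt_trans (ler_normB _ _))//.
have := cP k; have := yB k => /=; lra.
Qed.

(** An open set is a countable union of rational cubes, and an open cube is a finite intersection of
    complements of half-spaces, two for each coordinate. *)
Lemma borel_half_spaces (A : set (borel 'cV[R]_n)) : measurable A -> <<s half_spaces >> A.
Proof.
apply: smallest_sub; first exact: smallest_sigma_algebra.
move=> U oU.
pose H := g_sigma_algebraType half_spaces.
have mge u (a : R) : measurable ([set x | a <= dotv u x] : set H).
  by apply: sub_sigma_algebra; exists (dotv u), a; split=> //; exists u.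
have mball i : measurable (rational_ball i : set H).
  have -> : rational_ball i = \bigcap_(k in [set: 'I_n])
      (~` [set x | ratr (i.1 k 0) + ratr i.2 <= dotv (delta_mx k 0) x] `&`
       ~` [set x | ratr i.2 - ratr (i.1 k 0) <= dotv (- delta_mx k 0) x]).
    apply/seteqP; split=> x /=.
      move=> xB k _; have := xB k; rewrite ltr_norml => /andP[x1 x2].
      split=> /=; rewrite ?dotvNl dotv_delta; apply/negP; rewrite -ltNge; lra.
    move=> xB k; have [/= + /=] := xB k I; rewrite dotvNl !dotv_delta.
    move=> /negP; rewrite -ltNge => x1 /negP; rewrite -ltNge => x2.
    by rewrite ltr_norml; lra.
  apply: fin_bigcap_measurable => // k _.
  by apply: measurableI; apply: measurableC; exact: mge.
have -> : U = \bigcup_(j : nat) (if unpickle j is Some i then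
    if pselect (rational_ball i `<=` U) then rational_ball i else set0 else set0).
  apply/seteqP; split=> x.
    move=> Ux; have /rational_ball_nbhs[i [ix iU]] : nbhs x U by exact: open_nbhs_nbhs.
    by exists (pickle i) => //; rewrite pickleK; case: pselect.
  by move=> [j _]; case: unpickle => // i; case: pselect => // iU; exact: iU.
apply: (@bigcupT_measurable _ H) => j; case: unpickle => // i.
by case: pselect => [?|?] /=.
Qed.

Lemma cramer_wold_cV (P1 P2 : probability (borel 'cV[R]_n) R) :
  (forall u (B : set R), measurable B -> P1 (dotv u @^-1` B) = P2 (dotv u @^-1` B)) ->
  forall A, measurable A -> P1 A = P2 A.
Proof.
move=> law A mA; apply: (@cramer_wold _ (borel 'cV[R]_n) R P1 P2 (range (@dotv R n))).
- by move=> _ [u _ <-]; exact: measurable_dotv.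
- move=> a b _ _ [u _ <-] [v _ <-]; exists (a *: u + b *: v) => //.
  by apply/funext => x; rewrite dotvDl !dotvZl.
- exists 0 => //; apply/funext => x; rewrite -(scale0r 0) dotvZl mul0r//.
- by move=> _ [u _ <-]; exact: law.
- exact: borel_half_spaces.
Qed.

Lemma polish_cV : polish R 'cV[R]_n.
Proof.
split.
  exists (range (fun c : 'cV[rat]_n => \col_k (ratr (c k 0) : R))).
    by apply: (sub_countable (card_image_le _ _)); exact: countableP.
  move=> U [x Ux] oU.
  have /rational_ball_nbhs[[c r] [xr rU]] : nbhs x U by exact: open_nbhs_nbhs.
  exists (\col_k (ratr (c k 0) : R)); split; last by exists c.
  apply: rU => k /=; rewrite mxE subrr normr0.
  by have := xr k => /=; apply: le_lt_trans.
exists (fun x y => `|x - y|); split.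
  split.
  - move=> x y; split=> [/eqP|->]; last by rewrite subrr normr0.
    by rewrite normr_eq0 subr_eq0 => /eqP.
  - by move=> x y; rewrite distrC.
  - by move=> x y z; rewrite -(subrKA y) ler_normD.
  - move=> x A; split=> [/nbhs_ballP[e /= e0 eA]|[e e0 eA]].
      by exists e => // y xy; apply: eA; rewrite -ball_normE.
    by apply/nbhs_ballP; exists e => //= y; rewrite -ball_normE => /eA.
move=> u cu.
suff : cvgn u by move=> /cvg_ex.
apply: cauchy_cvg; apply/cauchyP => e e0; have [K KP] := cu e e0.
exists (u K); exists K => // m /= Km.
by rewrite -ball_normE; exact: KP.
Qed.

End column_vectors.

(** * Gaussian measures *)

Section normal_second_moment.
Variables (R : realType) (s : R).
Hypothesis s_neq0 : s != 0.
Local Notation mu := (@lebesgue_measure R).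
Local Notation pdf := (normal_pdf 0 s).

Let s2_gt0 : 0 < s ^+ 2. Proof. by rewrite exprn_even_gt0. Qed.

Let pdfE x : pdf x = normal_peak s * expR (- x ^+ 2 / (s ^+ 2 *+ 2)).
Proof. by rewrite normal_pdfE// /normal_fun subr0. Qed.

(** An antiderivative of [(x ^+ 2 - s ^+ 2) * pdf x], because [pdf] has derivative
    [- (x / s ^+ 2) * pdf x]. Its boundary terms vanish at infinity, leaving the second moment equal
    to [s ^+ 2] times the total mass. *)
Let G (x : R) : R := - s ^+ 2 * (x * pdf x).

Let is_derive_pdf (x : R) : is_derive x (1 : R) pdf (- (x / s ^+ 2) * pdf x).
Proof.
have di : is_derive x (1 : R) (@id R) 1 by exact: is_derive_id.
have dq := is_deriveZ (- (s ^+ 2 *+ 2)^-1) (is_deriveM di di).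
have dp := is_deriveZ (normal_peak s) (is_derive1_comp (is_derive_expR _) dq).
rewrite (_ : pdf = normal_peak s \*: (expR \o
    (- (s ^+ 2 *+ 2)^-1 \*: (@id R * @id R)))); last first.
  apply/funext => y; rewrite pdfE/=; congr (_ * expR _).
  by rewrite /GRing.scale/= expr2 mulNr mulrC mulNr.
apply: (is_derive_eq dp); rewrite /GRing.scale/=; move: (expR _) => e.
rewrite -[X in _ = _ * X]/(normal_peak s * e); field.
by rewrite s_neq0.
Qed.

Let is_derive_G (x : R) : is_derive x (1 : R) G ((x ^+ 2 - s ^+ 2) * pdf x).
Proof.
have di : is_derive x (1 : R) (@id R) 1 by exact: is_derive_id.
have dG := is_deriveZ (- s ^+ 2) (is_deriveM di (is_derive_pdf x)).
apply: (is_derive_eq dG); rewrite /GRing.scale/=; field.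
by rewrite s_neq0.
Qed.

Let continuous_pdf : continuous pdf. Proof. exact: continuous_normal_pdf. Qed.

Let integral_pdf_sym (k : R) : 0 < k ->
  (\int[mu]_(x in `[(- k)%R, k]) (x ^+ 2 * pdf x)%:E =
   (s ^+ 2)%:E * (\int[mu]_(x in `[(- k)%R, k]) (pdf x)%:E) +
   (- 2 * s ^+ 2 * (k * pdf k))%:E)%E.
Proof.
move=> k0.
have cf : continuous (fun x : R => (x ^+ 2 - s ^+ 2) * pdf x).
  move=> x; apply: cvgM; last exact: continuous_pdf.
  by apply: (@cvgB _ R^o); [exact: exprn_continuous|exact: cvg_cst].
have cG : continuous G.
  move=> x; apply: cvgM; first exact: cvg_cst.
  by apply: cvgM; [exact: cvg_id|exact: continuous_pdf].
have kk : - k < k by rewrite gtrN.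
have FTC := @continuous_FTC2 _ (fun x : R => (x ^+ 2 - s ^+ 2) * pdf x) G _ _ kk.
have {}FTC : (\int[mu]_(x in `[(- k)%R, k]) ((x ^+ 2 - s ^+ 2) * pdf x)%:E =
    (G k)%:E - (G (- k)%R)%:E)%E.
  apply: FTC.
  - exact: continuous_subspaceT.
  - split.
    + by move=> x _; case: (is_derive_G x).
    + exact/cvg_at_right_filter/cG.
    + exact/cvg_at_left_filter/cG.
  - by move=> x _; rewrite derive1E; exact: derive_val.
have ci (f : R -> R) : continuous f -> mu.-integrable `[- k, k] (EFin \o f).
  move=> cff; apply: continuous_compact_integrable; first exact: segment_compact.
  exact: continuous_subspaceT.
have i1 : mu.-integrable `[- k, k] (EFin \o (fun x : R => (x ^+ 2 - s ^+ 2) * pdf x)).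
  exact: ci.
have i2 : mu.-integrable `[- k, k] (EFin \o pdf) by exact: ci.
transitivity (\int[mu]_(x in `[(- k)%R, k])
    (((x ^+ 2 - s ^+ 2) * pdf x)%:E + (s ^+ 2)%:E * (pdf x)%:E))%E.
  by apply: eq_integral => x _; rewrite -EFinM -EFinD; congr EFin; ring.
rewrite integralD//; last by apply: integrableZl.
rewrite integralZl// FTC addeC; congr (_ + _)%E.
rewrite -EFinB; congr EFin; rewrite /G !pdfE sqrrN; ring.
Qed.

(** The bound [t <= expR t] at [t = y ^+ 2 / (s ^+ 2 *+ 2)] shows that [y * pdf y] is at most a
    constant over [y]. *)
Let cvg_pdf : k.+1%:R * pdf k.+1%:R @[k --> \oo] --> (0 : R).
Proof.
have peak0 := normal_peak_ge0 s.
apply: (@squeeze_cvgr _ _ _ _ (fun=> 0)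
  (fun k => (normal_peak s * (s ^+ 2 *+ 2)) * k.+1%:R^-1)).
- apply: nearW => k; rewrite mulr_ge0 ?normal_pdf_ge0//=.
  rewrite pdfE mulrCA -mulrA ler_wpM2l// mulNr expRN.
  set y := k.+1%:R; have y0 : 0 < y :> R by [].
  have t0 : 0 < s ^+ 2 *+ 2 by rewrite pmulrn_lgt0.
  rewrite ler_pdivrMr ?expR_gt0//.
  apply: (@le_trans _ _ (s ^+ 2 *+ 2 / y * (y ^+ 2 / (s ^+ 2 *+ 2)))).
    rewrite le_eqVlt; apply/orP; left; apply/eqP; field.
    by rewrite s_neq0 gt_eqF.
  rewrite ler_wpM2l//; first by rewrite divr_ge0// ltW.
  by apply: (le_trans _ (expR_ge1Dx _)); rewrite lerDr.
- exact: cvg_cst.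
- rewrite -[X in _ --> X](mulr0 (normal_peak s * (s ^+ 2 *+ 2))).
  by apply: cvgMl_tmp; exact: cvg_harmonic.
Qed.

Lemma integral_sqr_normal_pdf : (\int[mu]_x (x ^+ 2 * pdf x)%:E = (s ^+ 2)%:E)%E.
Proof.
pose F (k : nat) : set R := [set` `[(- k.+1%:R), k.+1%:R]].
have F_nd : {homo F : n m / (n <= m)%N >-> (n <= m)%O}.
  move=> n m nm; apply/subsetPset; apply: subset_itv; rewrite bnd_simp ?lerN2 ler_nat//.
have FT : \bigcup_k F k = setT.
  rewrite -subTset => x _; have [k xk] : exists k, `|x| <= k.+1%:R.
    exists (Num.bound `|x|); rewrite ltW//.
    by rewrite (lt_le_trans (archi_boundP (normr_ge0 x)))// ler_nat.
  by exists k => //; rewrite /F/= in_itv/= -ler_norml.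
have lim_int (f : R -> R) : measurable_fun setT f -> (forall x, 0 <= f x) ->
    (\int[mu]_(x in F k) (f x)%:E @[k --> \oo] --> \int[mu]_x (f x)%:E)%E.
  move=> mf f0; rewrite -FT; apply: ge0_nondecreasing_set_cvg_integral => //.
  - by move=> k; exact: measurable_itv.
  - by move=> k; apply/measurable_EFinP; exact: measurable_funTS.
  - by move=> k x _; rewrite lee_fin.
have m1 : measurable_fun setT (fun x : R => x ^+ 2 * pdf x).
  by apply: measurable_funM; [exact: measurable_funX|exact: measurable_normal_pdf].
have l1 := lim_int _ m1 (fun x => mulr_ge0 (sqr_ge0 x) (normal_pdf_ge0 0 s x)).
have l2 := lim_int _ (measurable_normal_pdf 0 s) (normal_pdf_ge0 0 s).
rewrite integral_normal_pdf in l2.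
have l3 : ((s ^+ 2)%:E * (\int[mu]_(x in F k) (pdf x)%:E) +
    (- 2 * s ^+ 2 * (k.+1%:R * pdf k.+1%:R))%:E @[k --> \oo] -->
    (s ^+ 2)%:E * 1 + 0)%E.
  apply: cvgeD => //; first exact: cvgeZl.
  apply: cvg_EFin; first exact: nearW.
  have := cvgMl_tmp (a := - 2 * s ^+ 2) cvg_pdf.
  by rewrite mulr0; apply.
rewrite mule1 adde0 in l3.
rewrite -(cvg_lim _ l1)// -(cvg_lim _ l3)//; congr (limn _).
by apply/funext => k; exact: integral_pdf_sym.
Qed.

End normal_second_moment.

Lemma image_probability d1 d2 (T1 : measurableType d1) (T2 : measurableType d2)
    (R : realType) (P : probability T1 R) (q : T1 -> T2) :
  measurable_fun setT q ->
  exists nu : probability T2 R, (nu : set T2 -> \bar R) = pushforward P q.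
Proof.
move=> mq; pose Q : {RV P >-> T2} := mfun_Sub (mem_set mq : q \in mfun).
by exists (distribution P Q).
Qed.

Section gaussian.
Variable R : realType.

Lemma normal_second_moment (s : R) : s != 0 ->
  (\int[normal_prob 0 s]_x (x ^+ 2)%:E = (s ^+ 2)%:E)%E.
Proof.
move=> s0; rewrite -(integral_sqr_normal_pdf s0).
have mx2 : measurable_fun setT (fun x : R => (x ^+ 2)%:E).
  by apply/measurable_EFinP; exact: measurable_funX.
(* With the identity map and weight 1 on the left, this is integration against the density of
   [normal_prob]. *)
have := @ge0_integral_weight _ _ (measurableTypeR R) (measurableTypeR R) R
  (normal_prob 0 s) lebesgue_measure id (fun=> 1) (normal_pdf 0 s)
  (@measurable_id _ _ _) (measurable_cst _) (measurable_normal_pdf 0 s)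
  (fun=> ler01) (normal_pdf_ge0 0 s) _ _ mx2.
move=> H; under eq_integral do rewrite -[(_ ^+ 2)%:E]mule1.
rewrite H//; last by move=> y; rewrite lee_fin sqr_ge0.
by move=> A mA; rewrite integral_cst// mul1e.
Qed.

Section fixed_dimension.
Variable n : nat.
Implicit Types (S : 'M[R]_n) (mu nu : probability (borel 'cV[R]_n) R).

Lemma gaussian_second_moment S mu u : is_gaussian S mu ->
  (\int[mu]_x ((dotv u x) ^+ 2)%:E = (dotv u (S *m u))%:E)%E.
Proof.
move=> [_ /(_ u) v0 /(_ u) law]; set v := dotv _ _ in v0 law *.
have mx2 : measurable_fun setT (fun x : R => (x ^+ 2)%:E).
  by apply/measurable_EFinP; exact: measurable_funX.
have x20 (x : R) : (0 <= (x ^+ 2)%:E)%E by rewrite lee_fin sqr_ge0.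
have md := @measurable_dotv R n u.
have [v_eq0|v_neq0] := eqVneq v 0.
  have im : is_image mu (dotv u) (\d_(0 : R) : {measure set R -> \bar R}).
    split=> // B mB; apply/esym.
    by have := law B mB; rewrite /centered_normal v_eq0 eqxx.
  rewrite -(ge0_integral_image im mx2 x20) integral_dirac// diracT mul1e.
  by rewrite expr0n v_eq0.
have im : @is_image _ _ (borel 'cV[R]_n) (measurableTypeR R) R mu (dotv u)
    (normal_prob 0 (Num.sqrt v)).
  split=> // B mB; apply/esym.
  by have := law B mB; rewrite /centered_normal (negPf v_neq0).
rewrite -(ge0_integral_image im mx2 x20) normal_second_moment ?sqr_sqrtr//.
by rewrite sqrtr_eq0 -ltNge lt_neqAle eq_sym v_neq0.
Qed.

Lemma gaussian_Lfun2 S mu u : is_gaussian S mu -> dotv u \in Lfun mu 2%:E.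
Proof.
move=> gS; apply/Lfun2P; split; first exact: measurable_dotv.
by rewrite (gaussian_second_moment _ gS) ltry.
Qed.

Lemma dotv_mulmx_sym S u w : S^T = S -> dotv u (S *m w) = dotv w (S *m u).
Proof.
move=> S_sym; rewrite /dotv.
under eq_bigr do rewrite mxE mulr_sumr.
under [RHS]eq_bigr do rewrite mxE mulr_sumr.
rewrite exchange_big; apply: eq_bigr => k _; apply: eq_bigr => l _.
by rewrite -[in RHS]S_sym mxE; ring.
Qed.

(** Polarization: the second moments of the forms given by [u], [w] and [u + w] determine the mixed
    one. *)
Lemma gaussian_covariance S mu u w : is_gaussian S mu ->
  \int[mu]_x (dotv u x * dotv w x) = dotv u (S *m w).
Proof.
move=> gS; have u2 := gaussian_Lfun2 u gS; have w2 := gaussian_Lfun2 w gS.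
have sq t : \int[mu]_x (dotv t x ^+ 2) = dotv t (S *m t).
  by rewrite /Rintegral (gaussian_second_moment _ gS).
have [S_sym _ _] := gS.
have := sq (u + w).
under eq_Rintegral do rewrite dotvDl.
have iuu := Lfun2_integrableM u2 u2; have iww := Lfun2_integrableM w2 w2.
have iuw := Lfun2_integrableM u2 w2.
pose F := fun i : 'I_3 => nth (fun=> 0)
  [:: (fun x => dotv u x * dotv u x); (fun x => dotv u x * dotv w x);
      (fun x => dotv w x * dotv w x)] i.
pose c := fun i : 'I_3 => nth 0 [:: 1; 2; 1 : R] i.
have Fi i : mu.-integrable setT (EFin \o F i) by case: i => -[|[|[|]]].
have [_] := Rintegral_suml c Fi.
rewrite ![in RHS]big_ord_recl big_ord0/= addr0 !mul1r => E E2.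
have {E2} : \int[mu]_x (\sum_i c i * F i x) = dotv (u + w) (S *m (u + w)).
  rewrite -E2; apply: eq_Rintegral => x _.
  by rewrite !big_ord_recl big_ord0 /c /F/=; ring.
rewrite E => E2.
have uu : \int[mu]_x (dotv u x * dotv u x) = dotv u (S *m u) by exact: sq.
have ww : \int[mu]_x (dotv w x * dotv w x) = dotv w (S *m w) by exact: sq.
move: E2; rewrite uu ww mulmxDr dotvDl 2!(dotvC _ (_ + _)) !dotvDl.
rewrite ![dotv (_ *m _) _]dotvC (dotv_mulmx_sym w u S_sym).
by move: (Rintegral _ _ _) (dotv _ _) (dotv _ _) (dotv _ _) => ? ? ? ?; lra.
Qed.

Lemma gaussian_unique S mu nu : is_gaussian S mu -> is_gaussian S nu ->
  forall A, measurable A -> mu A = nu A.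
Proof.
move=> [_ _ gmu] [_ _ gnu]; apply: cramer_wold_cV => u B mB.
by rewrite gmu// gnu.
Qed.

End fixed_dimension.

Lemma dotv_trmx m n (M : 'M[R]_(m, n)) (u : 'cV[R]_m) (x : 'cV[R]_n) :
  dotv u (M *m x) = dotv (M^T *m u) x.
Proof.
rewrite /dotv; under eq_bigr do rewrite mxE mulr_sumr.
under [RHS]eq_bigr do rewrite mxE mulr_suml.
rewrite exchange_big; apply: eq_bigr => k _; apply: eq_bigr => l _.
by rewrite mxE; ring.
Qed.

Lemma gaussian_image m n (S : 'M[R]_n) (M : 'M[R]_(m, n))
    (mu : probability (borel 'cV[R]_n) R) (nu : probability (borel 'cV[R]_m) R) :
  is_gaussian S mu -> is_image mu (mulmx M : borel 'cV[R]_n -> borel 'cV[R]_m) nu ->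
  is_gaussian (M *m S *m M^T) nu.
Proof.
move=> [S_sym S0 law] [mM imM].
have quad u : dotv u (M *m S *m M^T *m u) = dotv (M^T *m u) (S *m (M^T *m u)).
  by rewrite -!mulmxA dotv_trmx.
split.
- by rewrite !trmx_mul trmxK S_sym mulmxA.
- by move=> u; rewrite quad.
- move=> u B mB; rewrite imM; last first.
    by rewrite -[X in measurable X]setTI; exact: measurable_dotv.
  rewrite quad -law//; congr (mu _).
  by apply/seteqP; split=> x /=; rewrite dotv_trmx.
Qed.

Lemma gaussian_gm_space n (S : 'M[R]_n) (mu : probability (borel 'cV[R]_n) R) :
  is_gaussian S mu -> gm_space (euclid_gm mu).
Proof.
move=> gS; split.
- exact: polish_cV.
- have x2 k : (fun x : borel 'cV[R]_n => x k 0) \in Lfun mu 2%:E.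
    rewrite (_ : (fun x => _) = dotv (delta_mx k 0)); first exact: gaussian_Lfun2 gS.
    by apply/funext => x; rewrite dotv_delta.
  rewrite (_ : (fun z => _) = gauge_of (fun=> 1)
      (fun k (x : borel 'cV[R]_n) => x k 0)).
    exact: gauge_of_Lfun2.
  by apply/funext => z; apply: eq_bigr => k _; rewrite mul1r.
- by apply: aeW => -[x y]; exact: dotvC.
Qed.

End gaussian.

(** * Gromov-Wasserstein costs *)

Section covariance_domination.
Context d (T : measurableType d) (R : realType) (P : probability T R).

Lemma Rintegral_sqrB (mu : {measure set T -> \bar R}) (f g : T -> R) :
  f \in Lfun mu 2%:E -> g \in Lfun mu 2%:E ->
  \int[mu]_x ((f x - g x) ^+ 2) =
  \int[mu]_x (f x ^+ 2) - 2 * \int[mu]_x (f x * g x) + \int[mu]_x (g x ^+ 2).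
Proof.
move=> f2 g2.
have iff := Lfun2_integrableM f2 f2; have igg := Lfun2_integrableM g2 g2.
have ifg := Lfun2_integrableM f2 g2.
pose F := fun i : 'I_3 => nth (fun=> 0)
  [:: (fun x => f x * f x); (fun x => f x * g x); (fun x => g x * g x)] i.
pose w := fun i : 'I_3 => nth 0 [:: 1; - 2; 1 : R] i.
have Fint i : mu.-integrable setT (EFin \o F i) by case: i => -[|[|[|]]].
have [_] := Rintegral_suml w Fint.
rewrite ![in RHS]big_ord_recl big_ord0/= addr0 !mul1r addrA mulNr => E.
rewrite -[RHS]E; apply: eq_Rintegral => x _.
by rewrite !big_ord_recl big_ord0 /w/F/=; ring.
Qed.

Lemma Rintegral_mul_suml (mu : {measure set T -> \bar R}) m n
    (u : 'I_m -> R) (F : 'I_m -> T -> R) (v : 'I_n -> R) (G : 'I_n -> T -> R) :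
  (forall k, F k \in Lfun mu 2%:E) -> (forall k, G k \in Lfun mu 2%:E) ->
  \int[mu]_x ((\sum_k u k * F k x) * (\sum_l v l * G l x)) =
  \sum_k \sum_l u k * v l * \int[mu]_x (F k x * G l x).
Proof.
move=> F2 G2.
have FG k l := Lfun2_integrableM (F2 k) (G2 l).
have H k := Rintegral_suml v (FG k).
transitivity (\int[mu]_x (\sum_k u k * \sum_l v l * (F k x * G l x))).
  apply: eq_Rintegral => x _; rewrite mulr_suml; apply: eq_bigr => k _.
  by rewrite -mulrA mulr_sumr; congr (_ * _); apply: eq_bigr => l _; ring.
rewrite (Rintegral_suml u (fun k => (H k).1)).2; apply: eq_bigr => k _.
by rewrite (H k).2 mulr_sumr; apply: eq_bigr => l _; rewrite mulrA.
Qed.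

(** An upper bound on the covariance as a quadratic form. It passes to conditional expectations,
    whose covariance need not be diagonal. *)
Definition covariance_dominated m (a : 'I_m -> R) (Z : 'I_m -> T -> R) :=
  (forall k, Z k \in Lfun P 2%:E) /\
  forall u, \int[P]_x ((\sum_k u k * Z k x) ^+ 2) <= \sum_k a k * u k ^+ 2.

(** Cauchy-Schwarz in L2 turns the two domination hypotheses into the bilinear bound on the
    cross-covariances. *)
Lemma cross_covariance_le m n p (a : 'I_m -> R) (b : 'I_n -> R) Z Y :
  (m <= p)%N -> (n <= p)%N ->
  (forall k, 0 < a k) -> (forall k l : 'I_m, (k <= l)%N -> a l <= a k) ->
  (forall k, 0 < b k) -> (forall k l : 'I_n, (k <= l)%N -> b l <= b k) ->
  covariance_dominated a Z -> covariance_dominated b Y ->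
  Rintegral (P \x P)%E setT
    (fun z => gauge_of (fun=> 1) Z z * gauge_of (fun=> 1) Y z) <=
  \sum_(k < p) pad0 a k * pad0 b k.
Proof.
move=> mp np a0 a_dec b0 b_dec [Z2 Za] [Y2 Yb].
rewrite (Rintegral_gauge_of _ _ Z2 Y2).
under eq_bigr do under eq_bigr do rewrite !mul1r.
apply: sum_sqr_bilinear_le => // u v.
rewrite -(Rintegral_mul_suml u v Z2 Y2).
apply: (le_trans (Rintegral_CauchySchwarz (Lfun2_sum u Z2) (Lfun2_sum v Y2))).
by apply: ler_pM => //; apply: Rintegral_ge0 => x _; exact: sqr_ge0.
Qed.

(** A stand-in for the conditional expectation at indices of weight zero, where no coupling is
    supplied. *)
Lemma covariance_dominated0 m (a : 'I_m -> R) : (forall k, 0 <= a k) ->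
  covariance_dominated a (fun _ _ => 0).
Proof.
move=> a0; split=> [k|u]; first exact: Lfun2_0.
under eq_Rintegral do (under eq_bigr do rewrite mulr0; rewrite big1// expr0n).
rewrite Rintegral_cst// mul0r sumr_ge0// => k _.
by rewrite mulr_ge0// sqr_ge0.
Qed.

Lemma covariance_dominated_diag m (a : 'I_m -> R) Z :
  (forall k, Z k \in Lfun P 2%:E) ->
  (forall k l, \int[P]_x (Z k x * Z l x) = a k * (k == l)%:R) ->
  covariance_dominated a Z.
Proof.
move=> Z2 Za; split=> // u; rewrite (Rintegral_mul_suml u u Z2 Z2).
apply: ler_sum => k _; rewrite (bigD1 k)//= big1 ?addr0 => [|l lk].
  by rewrite Za eqxx mulr1 mulrC expr2.
by rewrite Za eq_sym (negPf lk) !mulr0.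
Qed.

End covariance_domination.

(** * Rectangular diagonal matrices, principal coordinates and transport maps *)

Section padding.
Variable R : realType.

Lemma pad_colsE m n (mn : (m <= n)%N) (B : 'M[R]_m) k l :
  pad_cols mn B k l = pad0 (B k) l.
Proof.
rewrite /pad_cols castmxE mxE /=; case: splitP => j /= lj.
  by rewrite cast_ord_id lj pad0E.
by rewrite mxE pad0_default// lj leq_addr.
Qed.

Lemma pad_squareE m n (mn : (m <= n)%N) (B : 'M[R]_m) k l :
  pad_square mn B k l = pad0 (fun i => pad0 (B i) l) k.
Proof.
rewrite /pad_square castmxE mxE /=; case: splitP => i /= ki.
  rewrite ki pad0E mxE; case: splitP => j /= lj; first by rewrite lj pad0E.
  by rewrite mxE pad0_default// lj leq_addr.
rewrite pad0_default ?ki ?leq_addr// mxE.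
by case: splitP => j _; rewrite mxE.
Qed.

Definition rect_diag m n (c : 'I_m -> R) : 'M[R]_(m, n) :=
  \matrix_(k, l) (c k * ((k : nat) == l)%:R).

Lemma rect_diag_mul m n (mn : (m <= n)%N) (c : 'I_m -> R) (x : 'cV[R]_n) k :
  (rect_diag n c *m x) k 0 = c k * x (widen_ord mn k) 0.
Proof.
rewrite mxE (bigD1 (widen_ord mn k))//= big1 ?addr0.
  by rewrite mxE/= eqxx mulr1.
move=> l; rewrite mxE -val_eqE/= eq_sym => /negPf ->.
by rewrite mulr0 mul0r.
Qed.

Lemma rect_diag_conj m n (mn : (m <= n)%N) (c : 'I_m -> R) (D : 'M[R]_n) :
  is_diag_mx D ->
  rect_diag n c *m D *m (rect_diag n c)^T =
  diag_mx (\row_k (c k ^+ 2 * D (widen_ord mn k) (widen_ord mn k))).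
Proof.
move=> /is_diag_mxP D_diag; apply/matrixP => k l.
rewrite !mxE (bigD1 (widen_ord mn k))//= big1 ?addr0 => [|j]; last first.
  move=> jk; rewrite mxE big1 ?mul0r// => i _; rewrite mxE.
  have [ik|ik] := eqVneq (k : nat) i; last by rewrite mulr0 mul0r.
  by rewrite D_diag ?mulr0// -ik; move: jk; rewrite -val_eqE eq_sym.
rewrite mxE (bigD1 (widen_ord mn k))//= big1 ?addr0 => [|j]; last first.
  by rewrite -val_eqE/= mxE eq_sym => /negPf ->; rewrite mulr0 mul0r.
rewrite !mxE/= eqxx mulr1; have [<-|kl] := eqVneq k l.
  by rewrite eqxx !mulr1n/= mulr1; ring.
have /negPf -> : (l : nat) != k by rewrite val_eqE eq_sym.
by rewrite mulr0n !mulr0.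
Qed.

End padding.

Section principal_coordinates.
Variables (R : realType) (n : nat) (S P D : 'M[R]_n).
Variable mu : probability (borel 'cV[R]_n) R.
Hypotheses (mu_gaussian : is_gaussian S mu) (P_orthogonal : orthogonal_mx P)
  (D_diag : is_diag_mx D) (SE : S = P *m D *m P^T).

Definition pcoord (Q : 'M[R]_n) (k : 'I_n) (x : borel 'cV[R]_n) : R :=
  (Q^T *m (x : 'cV[R]_n)) k 0.

Lemma pcoordE k x : pcoord P k x = dotv (col k P) x.
Proof. by rewrite /pcoord mulmx_dotv -tr_col trmxK. Qed.

Lemma pcoord_Lfun2 k : pcoord P k \in Lfun mu 2%:E.
Proof.
rewrite (_ : pcoord P k = dotv (col k P)); first exact: gaussian_Lfun2 mu_gaussian.
by apply/funext => x; rewrite pcoordE.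
Qed.

Lemma pcoord_covariance k l :
  \int[mu]_x (pcoord P k x * pcoord P l x) = D k k * (k == l)%:R.
Proof.
under eq_Rintegral do rewrite !pcoordE.
have PP : P^T *m P = 1%:M by rewrite mulmx1C.
rewrite (gaussian_covariance _ _ mu_gaussian) SE -!mulmxA dotv_trmx.
have Pcol j : P^T *m col j P = delta_mx j 0.
  by rewrite !colE mulmxA PP mul1mx.
rewrite !Pcol dotv_delta -colE mxE.
have [->|kl] := eqVneq k l; first by rewrite mulr1.
by move/is_diag_mxP : D_diag => ->; rewrite ?mulr0// .
Qed.

Lemma dotv_pcoord (x y : 'cV[R]_n) : dotv x y = \sum_k pcoord P k x * pcoord P k y.
Proof.
rewrite -[RHS]/(dotv (P^T *m x) (P^T *m y)) dotv_trmx trmxK mulmxA.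
by rewrite P_orthogonal mul1mx.
Qed.

Lemma dotv_gauge_of (z : borel 'cV[R]_n * borel 'cV[R]_n) :
  dotv z.1 z.2 = gauge_of (fun=> 1) (pcoord P) z.
Proof. by rewrite dotv_pcoord; apply: eq_bigr => k _; rewrite mul1r. Qed.

(** Nonnegative as the variance of a principal coordinate, nonzero as a factor of the determinant of
    [S]. *)
Lemma eigenvalue_gt0 k : S \in unitmx -> 0 < D k k.
Proof.
move=> S_unit; rewrite lt_neqAle; apply/andP; split; last first.
  rewrite -[D k k]mulr1 -[1]/((true)%:R) -(eqxx k) -pcoord_covariance.
  by apply: Rintegral_ge0 => x _; rewrite -expr2 sqr_ge0.
apply/negP => /eqP Dk0; move: S_unit.
rewrite unitmxE SE !det_mulmx det_tr.
have -> : D = diag_mx (\row_j D j j).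
  apply/matrixP => i j; rewrite !mxE; have [->|ij] := eqVneq i j; first by rewrite mulr1n.
  by move/is_diag_mxP : D_diag => ->.
rewrite det_diag (bigD1 k)//= mxE -Dk0 mul0r mulr0 mul0r.
by rewrite unitr0.
Qed.

End principal_coordinates.

Section transport.
Variable R : realType.

Lemma invmx_diag_mx n (w : 'rV[R]_n) : (forall k, w 0 k != 0) ->
  invmx (diag_mx w) = diag_mx (\row_k (w 0 k)^-1).
Proof.
move=> w0; set V := diag_mx (\row_k _).
have wV : diag_mx w *m V = 1%:M.
  rewrite mulmx_diag; apply/matrixP => k l; rewrite !mxE.
  by rewrite mulfV.
have [w_unit _] := mulmx1_unit wV.
by rewrite -[LHS]mulmx1 -wV mulKmx.
Qed.

Lemma transport_mxE m n (mn : (m <= n)%N) (s : 'rV[R]_m) (D : 'M[R]_m) (D1 : 'M[R]_n) :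
  (forall k, 0 < D1 k k) ->
  transport_mx mn (diag_mx s) D D1 = rect_diag n (fun k =>
    s 0 k * Num.sqrt (D k k) / Num.sqrt (D1 (widen_ord mn k) (widen_ord mn k))).
Proof.
move=> D1_gt0; apply/matrixP => k l; rewrite pad_colsE /diag_sqrt invmx_diag_mx.
  rewrite !mulmx_diag mxE /pad0.
  case: insubP => [j _ jl|]; last first.
    rewrite -leqNgt => ml /=; rewrite (_ : ((k : nat) == l) = false) ?mulr0//.
    by apply/negbTE; rewrite neq_ltn (leq_trans (ltn_ord k) ml).
  by rewrite /= /upper_left !mxE -jl mulr_natr val_eqE.
by move=> j; rewrite /upper_left !mxE gt_eqF// sqrtr_gt0.
Qed.

Lemma pcoord_rect_diag m n (mn : (m <= n)%N) (P : 'M[R]_m) (Q : 'M[R]_n) c x k :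
  orthogonal_mx P ->
  pcoord P k (P *m rect_diag n c *m Q^T *m x) = c k * pcoord Q (widen_ord mn k) x.
Proof.
move=> PP; have PP' : P^T *m P = 1%:M by rewrite mulmx1C.
by rewrite /pcoord !mulmxA PP' mul1mx -mulmxA (rect_diag_mul mn).
Qed.

Lemma rect_diag_covariance m n (mn : (m <= n)%N) (P D : 'M[R]_m)
    (Q E : 'M[R]_n) (c : 'I_m -> R) (M := P *m rect_diag n c *m Q^T) :
  orthogonal_mx Q -> is_diag_mx E -> is_diag_mx D ->
  (forall k, D k k = c k ^+ 2 * E (widen_ord mn k) (widen_ord mn k)) ->
  M *m (Q *m E *m Q^T) *m M^T = P *m D *m P^T.
Proof.
move=> QQ E_diag D_diag DE; have QQ' : Q^T *m Q = 1%:M by rewrite mulmx1C.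
rewrite /M !trmx_mul trmxK !mulmxA -(mulmxA _ Q^T Q) QQ' mulmx1.
rewrite -(mulmxA _ Q^T Q) QQ' mulmx1 -!mulmxA; congr (_ *m _).
rewrite !mulmxA; congr (_ *m _); rewrite rect_diag_conj//.
apply/matrixP => k l; rewrite !mxE.
have [<-|kl] := eqVneq k l; first by rewrite -DE mulr1n.
by move/is_diag_mxP : D_diag => ->; rewrite ?mulr0n.
Qed.

Lemma measurable_mulmx m n (M : 'M[R]_(m, n)) :
  measurable_fun setT (mulmx M : borel 'cV[R]_n -> borel 'cV[R]_m).
Proof. by apply: continuous_borel_measurable; exact: continuous_mulmx. Qed.

Lemma gaussian_image_exists m n (S : 'M[R]_n) (M : 'M[R]_(m, n))
    (mu : probability (borel 'cV[R]_n) R) : is_gaussian S mu ->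
  exists nu, is_gaussian (M *m S *m M^T) nu /\
    is_image mu (mulmx M : borel 'cV[R]_n -> borel 'cV[R]_m) nu.
Proof.
move=> gS; have [nu nuE] := image_probability mu (measurable_mulmx M).
have im : is_image mu (mulmx M : borel 'cV[R]_n -> borel 'cV[R]_m) nu.
  split; first exact: measurable_mulmx.
  by move=> A mA; exact: (congr1 (fun m => m A) nuE).
by exists nu; split; first exact: gaussian_image gS im.
Qed.

(** The given [nu] and the push-forward under [M] have the same Gaussian projections, so uniqueness
    identifies them on Borel sets. *)
Lemma gaussian_is_image m n (S : 'M[R]_n) (M : 'M[R]_(m, n))
    (mu : probability (borel 'cV[R]_n) R) (nu : probability (borel 'cV[R]_m) R) :
  is_gaussian S mu -> is_gaussian (M *m S *m M^T) nu ->
  is_image mu (mulmx M : borel 'cV[R]_n -> borel 'cV[R]_m) nu.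
Proof.
move=> gS gM; have [nu' [gM' [mM imM]]] := gaussian_image_exists M gS.
by split=> // A mA; rewrite -imM//; exact: gaussian_unique gM gM' A mA.
Qed.

End transport.

(** * Couplings with an arbitrary gm-space *)

Section gromov_wasserstein.
Variable R : realType.
Implicit Types X Y W : gm_triple R.

Lemma integral_sqr_dist d (T : measurableType d) (mu : {measure set T -> \bar R})
    (f g : T -> R) : f \in Lfun mu 2%:E -> g \in Lfun mu 2%:E ->
  (\int[mu]_z (`|f z - g z| ^+ 2)%:E = (\int[mu]_z ((f z - g z) ^+ 2)%R)%:E)%E.
Proof.
move=> f2 g2; have fg2 := Lfun2B f2 g2.
rewrite /Rintegral fineK; last first.
  exact: (integrable_fin_num measurableT (Lfun2_integrable_sqr fg2)).
by apply: eq_integral => z _; rewrite real_normK ?num_real.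
Qed.

Lemma GW_cost_ge0 X Y pi : (0 <= @GW_cost R X Y pi)%E.
Proof. by apply: integral_ge0 => z _; rewrite lee_fin exprn_ge0. Qed.

Lemma GW_ge0 X Y : (0 <= GW X Y)%E.
Proof. by apply/ereal_infP => _ [pi _ <-]; exact: sqrte_ge0. Qed.

Lemma GW_sqr_le X Y pi : coupling X Y pi -> (GW X Y ^+ 2 <= GW_cost X Y pi)%E.
Proof.
move=> cpi; rewrite -[leRHS]sqr_sqrte ?GW_cost_ge0//.
have le_GW : (GW X Y <= sqrte (GW_cost X Y pi))%E by apply: ge_ereal_inf; exists (sqrte (GW_cost X Y pi)); [exists pi|].
by rewrite !expe2 lee_pmul// GW_ge0.
Qed.

Lemma GW_sqr_approx X Y (e : R) : GW X Y \is a fin_num -> 0 < e ->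
  exists2 pi, coupling X Y pi &
    (GW_cost X Y pi <= ((fine (GW X Y) + e) ^+ 2)%:E)%E.
Proof.
move=> GW_fin e0; have [_ [pi cpi <-] pi_lt] := lb_ereal_inf_adherent e0 GW_fin.
exists pi => //; rewrite -[leLHS]sqr_sqrte ?GW_cost_ge0// EFin_expe EFinD fineK//.
by rewrite !expe2 lee_pmul// ?sqrte_ge0// ltW.
Qed.

Lemma coupling_fst X Y pi : coupling X Y pi ->
  is_image pi (fst : borel (gm_carrier X * gm_carrier Y)%type -> borel (gm_carrier X))
    (gm_measure X).
Proof.
move=> [pi1 _]; split; last by move=> A mA; exact: (esym (pi1 A mA)).
by apply: continuous_borel_measurable => z; exact: cvg_fst.
Qed.

Lemma coupling_snd X Y pi : coupling X Y pi ->
  is_image pi (snd : borel (gm_carrier X * gm_carrier Y)%type -> borel (gm_carrier Y))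
    (gm_measure Y).
Proof.
move=> [_ pi2]; split; last by move=> A mA; exact: (esym (pi2 A mA)).
by apply: continuous_borel_measurable => z; exact: cvg_snd.
Qed.

(* Replacing the coordinates by their conditional expectations given the second
   component removes the coupling from the cross term of the cost. *)
Lemma coupling_projection n (S P D : 'M[R]_n) (mu : probability (borel 'cV[R]_n) R)
    W pi :
  is_gaussian S mu -> orthogonal_mx P -> is_diag_mx D -> S = P *m D *m P^T ->
  gm_space W -> coupling (euclid_gm mu) W pi ->
  let nu := gm_measure W in
  let h := fun z : borel (gm_carrier W) * borel (gm_carrier W) => gm_gauge z.1 z.2 in
  exists E : 'I_n -> borel (gm_carrier W) -> R,
    covariance_dominated nu (fun k => D k k) E /\
    GW_cost (euclid_gm mu) W pi =
      (\sum_k D k k ^+ 2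
       - 2 * Rintegral (nu \x nu)%E setT (fun z => gauge_of (fun=> 1) E z * h z)
       + Rintegral (nu \x nu)%E setT (fun z => h z ^+ 2))%:E.
Proof.
move=> gS PP D_diag SE [_ h2 _] cpi nu h.
have im1 := coupling_fst cpi; have im2 := coupling_snd cpi.
have im22 := is_image_prod im2.
pose F k := pcoord P k \o (fst : borel (gm_carrier (euclid_gm mu) * gm_carrier W)%type
  -> borel 'cV[R]_n).
have Z2 k := pcoord_Lfun2 P gS k.
have F2 k : F k \in Lfun pi 2%:E by exact: (image_Lfun2 im1 (Z2 k)).
have FF k l : \int[pi]_x (F k x * F l x) = D k k * (k == l)%:R.
  rewrite -(pcoord_covariance gS PP D_diag SE).
  rewrite -(Rintegral_image im1 (f := fun x => pcoord P k x * pcoord P l x))//.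
  by apply: measurable_funM; [exact: (Lfun2_measurable (Z2 k))|
    exact: (Lfun2_measurable (Z2 l))].
have [E [FE gFE]] := L2_projection_gauge im2 F2.
exists E; split.
  split=> [k|u]; first by case: (FE k).
  (* A linear combination of the [E k] is the projection of the same combination of the [F k], so
     its second moment can only decrease. *)
  apply: le_trans (L2_projection_le im2 (L2_projection_sum im2 u FE)) _.
  by have [_] := covariance_dominated_diag F2 FF; exact.
have gF2 := gauge_of_Lfun2 (fun=> 1) F2.
have hq2 := image_Lfun2 im22 h2.
transitivity (\int[(pi \x pi)%E]_z
    (`|gauge_of (fun=> 1) F z - (h \o (fun z => (z.1.2, z.2.2))) z| ^+ 2)%:E)%E.
  apply: eq_integral => z _ /=; congr ((`|_ - _| ^+ 2)%:E).
  exact: (dotv_gauge_of PP (z.1.1, z.2.1)).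
rewrite (integral_sqr_dist gF2 hq2) (Rintegral_sqrB gF2 hq2); congr EFin.
congr (_ - 2 * _ + _).
- transitivity (\sum_k \sum_l 1 * 1 * (\int[pi]_x (F k x * F l x)) ^+ 2).
    by rewrite -(Rintegral_gauge_of _ _ F2 F2).
  apply: eq_bigr => k _; rewrite (bigD1 k)//= big1 ?addr0 => [|l lk].
    by rewrite FF eqxx !mul1r mulr1.
  by rewrite FF eq_sym (negPf lk) mulr0 expr0n mulr0.
- by have [_ _ cross] := gFE (fun=> 1); exact: (cross h h2).
- rewrite -(Rintegral_image im22 (f := fun z => h z ^+ 2))//.
  by apply: measurable_funX; exact: (Lfun2_measurable h2).
Qed.

End gromov_wasserstein.

Lemma continuous_prod_topology (I : Type) (T : ptopologicalType)
    (K : I -> ptopologicalType) (f : T -> prod_topology K) :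
  (forall i, continuous (fun x => f x i)) -> continuous f.
Proof.
move=> cf x; apply/cvg_sup => i.
apply: (@continuous_comp_initial _ _ _ (fun g : (forall i, K i) => g i) f _ x).
exact: cf.
Qed.

Lemma continuous_pair (T U V : ptopologicalType) (f : T -> U) (g : T -> V) :
  continuous f -> continuous g -> continuous (fun x => (f x, g x)).
Proof. by move=> cf cg x; apply: cvg_pair; [exact: cf|exact: cg]. Qed.

Lemma sum_pad0_widen (R : realFieldType) m n (mn : (m <= n)%N) (a : 'I_m -> R)
    (F : 'I_n -> R) :
  \sum_(k < n) pad0 a k * F k = \sum_k a k * F (widen_ord mn k).
Proof.
transitivity (\sum_(k < n) pad0 a k * pad0 F k).
  by apply: eq_bigr => k _; rewrite [pad0 F k]pad0E.
rewrite (sum_pad0 (F := fun k => pad0 a k * pad0 F k) mn) => [|k mk]; last first.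
  by rewrite pad0_default// mul0r.
by apply: eq_bigr => k _; rewrite pad0E -[X in pad0 F X]/(val (widen_ord mn k)) pad0E.
Qed.

(** * The Gaussian family: spectra, multi-marginal coupling and barycenter *)

Section gaussian_family.
Variables (R : realType) (N : nat) (d : 'I_N.+1 -> nat).
Hypothesis d_le : forall i, (d i <= d ord0)%N.
Variables (Sigma P D : forall i, 'M[R]_(d i)).
Variable xi : forall i, probability (borel 'cV[R]_(d i)) R.
Hypotheses (xi_gaussian : forall i, is_gaussian (Sigma i) (xi i))
  (Sigma_unit : forall i, Sigma i \in unitmx)
  (P_orthogonal : forall i, orthogonal_mx (P i))
  (D_diag : forall i, is_diag_mx (D i))
  (D_sorted : forall i (k l : 'I_(d i)), (k <= l)%N -> D i l l <= D i k k)
  (SigmaE : forall i, Sigma i = P i *m D i *m (P i)^T).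
Variables (J : forall i, 'M[R]_(d i)) (s : forall i, 'rV[R]_(d i)).
Hypotheses (JE : forall i, J i = diag_mx (s i))
  (s_sign : forall i k, s i 0 k = -1 \/ s i 0 k = 1).
Variable rho : 'I_N.+1 -> R.
Hypotheses (rho_ge0 : forall i, 0 <= rho i) (rho_sum : \sum_i rho i = 1).

Let xi0 := xi ord0.
Let X i := euclid_gm (xi i).

Definition spectrum i (k : 'I_(d i)) : R := D i k k.
Arguments spectrum : clear implicits.

Definition pspectrum i (k : 'I_(d ord0)) : R := pad0 (spectrum i) k.

Definition mean_spectrum (k : 'I_(d ord0)) : R := \sum_i rho i * pspectrum i k.

Definition std_coord (k : 'I_(d ord0)) (x : borel 'cV[R]_(d ord0)) : R :=
  (Num.sqrt (spectrum ord0 k))^-1 * pcoord (P ord0) k x.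

Lemma spectrum_gt0 i k : 0 < spectrum i k.
Proof. exact: (eigenvalue_gt0 (xi_gaussian i)). Qed.
Arguments spectrum_gt0 : clear implicits.

Lemma pspectrum_ge0 i k : 0 <= pspectrum i k.
Proof. by apply: pad0_ge0 => j; exact/ltW/spectrum_gt0. Qed.

Lemma mean_spectrum_ge0 k : 0 <= mean_spectrum k.
Proof. by apply: sumr_ge0 => i _; rewrite mulr_ge0 ?pspectrum_ge0. Qed.

Lemma std_coord_Lfun2 k : std_coord k \in Lfun xi0 2%:E.
Proof. by apply: Lfun2Z; exact: (pcoord_Lfun2 _ (xi_gaussian ord0)). Qed.

Lemma std_coord_covariance k l :
  \int[xi0]_x (std_coord k x * std_coord l x) = (k == l)%:R.
Proof.
pose c j := (Num.sqrt (spectrum ord0 j))^-1.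
have Z2 j := pcoord_Lfun2 (P ord0) (xi_gaussian ord0) j.
transitivity (c k * c l *
    \int[xi0]_x (pcoord (P ord0) k x * pcoord (P ord0) l x)).
  rewrite -RintegralZl//; last exact: (Lfun2_integrableM (Z2 k) (Z2 l)).
  by apply: eq_Rintegral => x _; rewrite /std_coord -/(c k) -/(c l); ring.
rewrite (pcoord_covariance (xi_gaussian ord0) (P_orthogonal ord0) (D_diag ord0) (SigmaE ord0)).
have [<-|_] := eqVneq k l; last by rewrite !mulr0.
have l0 := spectrum_gt0 ord0 k.
rewrite mulr1 /c -invfM -expr2 sqr_sqrtr ?ltW// mulVf// gt_eqF//.
Qed.

(** The tensor squares of the standardized coordinates are orthonormal, so diagonal kernels have the
    geometry of their coefficient vectors. *)
Lemma Rintegral_std_gauge (a b : 'I_(d ord0) -> R) :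
  Rintegral (xi0 \x xi0)%E setT
    (fun z => gauge_of a std_coord z * gauge_of b std_coord z) =
  \sum_k a k * b k.
Proof.
rewrite (Rintegral_gauge_of _ _ std_coord_Lfun2 std_coord_Lfun2).
apply: eq_bigr => k _; rewrite (bigD1 k)//= big1 ?addr0 => [|l lk].
  by rewrite std_coord_covariance eqxx expr1n mulr1.
by rewrite std_coord_covariance eq_sym (negPf lk) expr0n mulr0.
Qed.

Definition transport i : 'M[R]_(d i, d ord0) :=
  P i *m transport_mx (d_le i) (J i) (D i) (D ord0) *m (P ord0)^T.

Let tscale i (k : 'I_(d i)) : R :=
  s i 0 k * Num.sqrt (spectrum i k) / Num.sqrt (spectrum ord0 (widen_ord (d_le i) k)).
Arguments tscale : clear implicits.

Let transportE i : transport i = P i *m rect_diag _ (tscale i) *m (P ord0)^T.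
Proof. by rewrite /transport JE transport_mxE// => k; exact: spectrum_gt0. Qed.

(** The scale factors enter laws and gauges only through their squares, so the signs drop out and
    every choice of [J] gives an optimal coupling. *)
Let sqr_tscale i k :
  tscale i k ^+ 2 = spectrum i k / spectrum ord0 (widen_ord (d_le i) k).
Proof.
have ss : s i 0 k ^+ 2 = 1 by case: (s_sign k) => ->; rewrite ?sqrrN expr1n.
rewrite /tscale exprMn exprVn exprMn ss mul1r.
by rewrite !sqr_sqrtr// ltW// spectrum_gt0.
Qed.

Lemma transport_image i :
  is_image xi0 (mulmx (transport i)
    : borel 'cV[R]_(d ord0) -> borel 'cV[R]_(d i)) (xi i).
Proof.
apply: gaussian_is_image (xi_gaussian ord0) _.
rewrite (SigmaE ord0) transportE (@rect_diag_covariance _ _ _ (d_le i) _ (D i))//.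
  by rewrite -SigmaE.
by move=> k; rewrite sqr_tscale divfK// gt_eqF//; exact: spectrum_gt0.
Qed.

Let pcoord_std k x : pcoord (P ord0) k x = Num.sqrt (spectrum ord0 k) * std_coord k x.
Proof.
by rewrite /std_coord mulrA divff ?mul1r// gt_eqF// sqrtr_gt0 spectrum_gt0.
Qed.

Lemma dotv_transport i (z : borel 'cV[R]_(d ord0) * borel 'cV[R]_(d ord0)) :
  dotv (transport i *m z.1) (transport i *m z.2) =
  gauge_of (pspectrum i) std_coord z.
Proof.
rewrite (dotv_pcoord (P_orthogonal i)) transportE.
rewrite /gauge_of (sum_pad0_widen (d_le i)); apply: eq_bigr => k _.
rewrite !(pcoord_rect_diag (d_le i))// !pcoord_std.
set w := widen_ord _ _; set t := tscale i k.
have w0 : 0 < spectrum ord0 w by exact: spectrum_gt0.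
transitivity (t ^+ 2 * Num.sqrt (spectrum ord0 w) ^+ 2 *
  (std_coord w z.1 * std_coord w z.2)); first by ring.
by rewrite sqr_tscale sqr_sqrtr ?ltW// divfK// gt_eqF.
Qed.

Definition mean_covariance : 'M[R]_(d ord0) :=
  \sum_(i < N.+1) rho i *: pad_square (d_le i) (D i).

Lemma mean_covarianceE k : mean_covariance k k = mean_spectrum k.
Proof.
rewrite summxE; apply: eq_bigr => i _; rewrite mxE pad_squareE /pspectrum /pad0.
by case: insubP => //= j _ jk; rewrite -jk valK.
Qed.

Lemma mean_covariance_diag : is_diag_mx mean_covariance.
Proof.
apply/is_diag_mxP => k l kl; rewrite summxE big1// => i _.
rewrite mxE pad_squareE /pad0.
case: insubP => [l' _ l'l|_]; last by case: insub => [?|] /=; rewrite mulr0.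
case: insubP => [k' _ k'k|_] /=; last by rewrite mulr0.
move/is_diag_mxP : (D_diag i) => -> /=; first by rewrite mulr0.
by rewrite k'k l'l.
Qed.

Let mscale (k : 'I_(d ord0)) : R :=
  Num.sqrt (mean_spectrum k) / Num.sqrt (spectrum ord0 k).

(** The identity takes the place of [P i] because the target covariance is already diagonal. Zero
    entries of [mean_spectrum] are harmless: only the positive spectrum of index [ord0] is divided
    by. *)
Definition mean_transport : 'M[R]_(d ord0) :=
  1%:M *m rect_diag _ mscale *m (P ord0)^T.

Let sqr_mscale k : mscale k ^+ 2 = mean_spectrum k / spectrum ord0 k.
Proof.
rewrite /mscale exprMn exprVn sqr_sqrtr ?mean_spectrum_ge0// sqr_sqrtr//.
exact/ltW/spectrum_gt0.
Qed.

Let widen_ord_id n (k : 'I_n) : widen_ord (leqnn n) k = k.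
Proof. exact: val_inj. Qed.

Lemma mean_transport_covariance :
  mean_transport *m Sigma ord0 *m mean_transport^T = mean_covariance.
Proof.
rewrite (SigmaE ord0) (@rect_diag_covariance _ _ _ (leqnn _) _ mean_covariance)//.
- by rewrite mul1mx trmx1 mulmx1.
- exact: mean_covariance_diag.
- move=> k; rewrite widen_ord_id mean_covarianceE sqr_mscale divfK// gt_eqF//.
  exact: spectrum_gt0.
Qed.

Lemma mean_gaussian_exists :
  exists upsilon : probability (borel 'cV[R]_(d ord0)) R,
    is_gaussian mean_covariance upsilon.
Proof.
have [nu [gnu _]] := gaussian_image_exists mean_transport (xi_gaussian ord0).
by exists nu; rewrite -mean_transport_covariance.
Qed.

Lemma mean_transport_image (upsilon : probability (borel 'cV[R]_(d ord0)) R) :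
  is_gaussian mean_covariance upsilon ->
  is_image xi0 (mulmx mean_transport
    : borel 'cV[R]_(d ord0) -> borel 'cV[R]_(d ord0)) upsilon.
Proof.
by move=> gu; apply: gaussian_is_image (xi_gaussian ord0) _;
  rewrite mean_transport_covariance.
Qed.

Lemma dotv_mean_transport (z : borel 'cV[R]_(d ord0) * borel 'cV[R]_(d ord0)) :
  dotv (mean_transport *m z.1) (mean_transport *m z.2) =
  gauge_of mean_spectrum std_coord z.
Proof.
have I1 : orthogonal_mx (1%:M : 'M[R]_(d ord0)).
  by rewrite /orthogonal_mx trmx1 mulmx1.
rewrite (dotv_pcoord I1); apply: eq_bigr => k _.
rewrite !(pcoord_rect_diag (leqnn _))// !widen_ord_id !pcoord_std.
have l0 := spectrum_gt0 ord0 k.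
transitivity (mscale k ^+ 2 * Num.sqrt (spectrum ord0 k) ^+ 2 *
  (std_coord k z.1 * std_coord k z.2)); first by ring.
by rewrite sqr_mscale sqr_sqrtr ?ltW// divfK// gt_eqF.
Qed.

Definition spectra_product i j : R := \sum_k pspectrum i k * pspectrum j k.

Lemma sum_sqr_spectrum i : \sum_k D i k k ^+ 2 = spectra_product i i.
Proof.
rewrite /spectra_product /pspectrum.
rewrite (sum_pad0 (F := fun k => pad0 (spectrum i) k * pad0 (spectrum i) k) (d_le i)).
  by apply: eq_bigr => k _; rewrite pad0E expr2.
by move=> k dk; rewrite pad0_default// mul0r.
Qed.

Lemma sum_sqr_mean_spectrum : \sum_k mean_spectrum k ^+ 2 =
  \sum_i \sum_j rho i * rho j * spectra_product i j.
Proof.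
transitivity (\sum_k \sum_i \sum_j
    rho i * rho j * (pspectrum i k * pspectrum j k)).
  apply: eq_bigr => k _; rewrite expr2 mulr_suml; apply: eq_bigr => i _.
  by rewrite mulr_sumr; apply: eq_bigr => j _; ring.
rewrite exchange_big; apply: eq_bigr => i _; rewrite exchange_big.
by apply: eq_bigr => j _; rewrite -mulr_sumr.
Qed.

(** The weighted variance of the spectra about their mean, which turns out to be the minimum of the
    functional; the next lemma is the usual identity for a variance. *)
Definition barycenter_value : R :=
  \sum_i rho i * \sum_k (pspectrum i k - mean_spectrum k) ^+ 2.

Lemma barycenter_valueE : barycenter_value =
  \sum_i rho i * spectra_product i i - \sum_k mean_spectrum k ^+ 2.
Proof.
transitivity (\sum_i rho i * spectra_product i i -
    2 * (\sum_k mean_spectrum k * \sum_i rho i * pspectrum i k) +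
    (\sum_i rho i) * \sum_k mean_spectrum k ^+ 2); last first.
  rewrite rho_sum -[X in 2 * X]/(\sum_k mean_spectrum k * mean_spectrum k).
  by under [X in 2 * X]eq_bigr do rewrite -expr2; ring.
under [X in 2 * X]eq_bigr do rewrite mulr_sumr.
rewrite exchange_big [2 * _]mulr_sumr [_ * \sum_k mean_spectrum k ^+ 2]mulr_suml.
rewrite -sumrB -big_split; apply: eq_bigr => i _ /=.
rewrite /spectra_product !mulr_sumr -sumrB -big_split.
by apply: eq_bigr => k _ /=; ring.
Qed.

Section marginals.
Context dT (T : measurableType dT) (Q : probability T R).
Variable q : forall i, T -> borel 'cV[R]_(d i).
Hypothesis q_image : forall i, is_image Q (q i) (xi i).

(** [T] is any probability space mapping to all the [X i]; it is instantiated by a multi-marginal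
    coupling with its coordinate maps. *)
Definition pullback_gauge i (z : T * T) : R := dotv (q i z.1) (q i z.2).

Let qcoord i k (x : T) := pcoord (P i) k (q i x).
Arguments qcoord : clear implicits.

Let qcoord_Lfun2 i k : qcoord i k \in Lfun Q 2%:E.
Proof. exact: (image_Lfun2 (q_image i) (pcoord_Lfun2 (P i) (xi_gaussian i) k)). Qed.

Let qcoord_covariance i k l :
  \int[Q]_x (qcoord i k x * qcoord i l x) = D i k k * (k == l)%:R.
Proof.
have Z2 j := pcoord_Lfun2 (P i) (xi_gaussian i) j.
rewrite -(pcoord_covariance (xi_gaussian i) (P_orthogonal i) (D_diag i) (SigmaE i)).
rewrite -(Rintegral_image (q_image i) (f := fun x => pcoord (P i) k x * pcoord (P i) l x))//.
by apply: measurable_funM; [exact: (Lfun2_measurable (Z2 k))|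
  exact: (Lfun2_measurable (Z2 l))].
Qed.

Let qcoord_dominated i : covariance_dominated Q (spectrum i) (qcoord i).
Proof. exact: covariance_dominated_diag. Qed.

Let pullback_gaugeE i : pullback_gauge i = gauge_of (fun=> 1) (qcoord i).
Proof.
by apply/funext => z; rewrite /pullback_gauge (dotv_gauge_of (P_orthogonal i) (_, _)).
Qed.

Lemma pullback_gauge_Lfun2 i : pullback_gauge i \in Lfun (Q \x Q)%E 2%:E.
Proof.
by rewrite pullback_gaugeE; apply: gauge_of_Lfun2 => k; case: (qcoord_dominated i).
Qed.

Lemma Rintegral_pullback_gauge_le i j :
  Rintegral (Q \x Q)%E setT (fun z => pullback_gauge i z * pullback_gauge j z) <=
  spectra_product i j.
Proof.
rewrite !pullback_gaugeE.
by apply: (cross_covariance_le (d_le i) (d_le j) (spectrum_gt0 i) _ (spectrum_gt0 j) _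
  (qcoord_dominated i) (qcoord_dominated j)) => k l; exact: D_sorted.
Qed.

(** This value depends on the marginal alone, so couplings differ in cost only through their cross
    terms. *)
Lemma Rintegral_pullback_gauge_sqr i :
  Rintegral (Q \x Q)%E setT (fun z => pullback_gauge i z ^+ 2) =
  spectra_product i i.
Proof.
rewrite pullback_gaugeE -sum_sqr_spectrum.
transitivity (\sum_k \sum_l 1 * 1 * (\int[Q]_x (qcoord i k x * qcoord i l x)) ^+ 2).
  by rewrite -(Rintegral_gauge_of _ _ (@qcoord_Lfun2 i) (@qcoord_Lfun2 i)).
apply: eq_bigr => k _; rewrite (bigD1 k)//= big1 ?addr0 => [|l lk].
  by rewrite qcoord_covariance eqxx !mul1r mulr1.
by rewrite qcoord_covariance eq_sym (negPf lk) mulr0 expr0n mulr0.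
Qed.

End marginals.

(** The coupling is the image of [xi0] under the pair of [transport i] and [mean_transport]. Both
    gauges become diagonal kernels, at the squared distance of their coefficient vectors. *)
Lemma GW_mean_le i (upsilon : probability (borel 'cV[R]_(d ord0)) R) :
  is_gaussian mean_covariance upsilon ->
  (GW (X i) (euclid_gm upsilon) ^+ 2 <=
   (\sum_k (pspectrum i k - mean_spectrum k) ^+ 2)%:E)%E.
Proof.
move=> gu; have [mT imT] := transport_image i; have [mM imM] := mean_transport_image gu.
pose q (x : borel 'cV[R]_(d ord0)) :
    borel (gm_carrier (X i) * gm_carrier (euclid_gm upsilon))%type :=
  (transport i *m (x : 'cV[R]_(d ord0)), mean_transport *m (x : 'cV[R]_(d ord0))).
have mq : measurable_fun setT q.
  apply: continuous_borel_measurable.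
  by apply: continuous_pair; exact: continuous_mulmx.
have [pi piE] := image_probability xi0 mq.
have cpi : coupling (X i) (euclid_gm upsilon) pi.
  split=> A mA; rewrite piE.
    by rewrite /pushforward; exact: (esym (imT A mA)).
  by rewrite /pushforward; exact: (esym (imM A mA)).
apply: (le_trans (GW_sqr_le cpi)).
have imq : is_image xi0 q pi by split=> // A mA; exact: (congr1 (fun m => m A) piE).
have [_ g2 _] := gaussian_gm_space (xi_gaussian i).
have [_ h2 _] := gaussian_gm_space gu.
have gq2 := image_Lfun2 (is_image_prod (coupling_fst cpi)) g2.
have hq2 := image_Lfun2 (is_image_prod (coupling_snd cpi)) h2.
rewrite /GW_cost (integral_sqr_dist gq2 hq2) lee_fin.
rewrite (Rintegral_image (is_image_prod imq)); last first.
  by apply: measurable_funX; exact: (Lfun2_measurable (Lfun2B gq2 hq2)).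
have a2 := gauge_of_Lfun2 (pspectrum i) std_coord_Lfun2.
have b2 := gauge_of_Lfun2 mean_spectrum std_coord_Lfun2.
rewrite (_ : Rintegral _ _ _ = Rintegral (xi0 \x xi0)%E setT
    (fun z => (gauge_of (pspectrum i) std_coord z -
               gauge_of mean_spectrum std_coord z) ^+ 2)); last first.
  apply: eq_Rintegral => z _; congr ((_ - _) ^+ 2).
    exact: dotv_transport.
  exact: dotv_mean_transport.
rewrite (Rintegral_sqrB a2 b2).
under eq_Rintegral do rewrite expr2.
under [X in _ + X <= _]eq_Rintegral do rewrite expr2.
rewrite !Rintegral_std_gauge mulr_sumr -sumrB -big_split.
by rewrite le_eqVlt; apply/orP; left; apply/eqP/eq_bigr => k _ /=; ring.
Qed.

(** Arbitrary cost bounds [c i] replace the squared distances so that near-optimal couplings can be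
    inserted. Zero weights are exempt because the distance at such an index is not shown to be
    finite. *)
Lemma barycenter_value_le W (c : 'I_N.+1 -> R) : gm_space W ->
  (forall i, rho i = 0 \/
     exists2 pi, coupling (X i) W pi & (GW_cost (X i) W pi <= (c i)%:E)%E) ->
  barycenter_value <= \sum_i rho i * c i.
Proof.
move=> Wgm cP; have [_ h2 _] := Wgm.
set h := (fun z => _) in h2; set nu := gm_measure W in h2.
set Q := (nu \x nu)%E in h2.
have EP i : exists E : 'I_(d i) -> borel (gm_carrier W) -> R,
    covariance_dominated nu (spectrum i) E /\
    rho i * (spectra_product i i
      - 2 * Rintegral Q setT (fun z => gauge_of (fun=> 1) E z * h z)
      + Rintegral Q setT (fun z => h z ^+ 2)) <= rho i * c i.
  case: (cP i) => [->|[pi cpi]].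
    exists (fun _ _ => 0); rewrite !mul0r; split=> //.
    by apply: covariance_dominated0 => k; exact/ltW/spectrum_gt0.
  have [E [Edom ->]] := coupling_projection (xi_gaussian i) (P_orthogonal i)
    (D_diag i) (SigmaE i) Wgm cpi.
  rewrite lee_fin => Ec; exists E; split=> //.
  by rewrite ler_wpM2l// -sum_sqr_spectrum.
pose E i := projT1 (cid (EP i)).
have Edom i : covariance_dominated nu (spectrum i) (E i).
  by rewrite /E; case: cid => ? [].
pose G i := gauge_of (fun=> 1) (E i).
have G2 i : G i \in Lfun Q 2%:E by apply: gauge_of_Lfun2; case: (Edom i).
have cost_le i : rho i * (spectra_product i i
      - 2 * Rintegral Q setT (fun z => G i z * h z)
      + Rintegral Q setT (fun z => h z ^+ 2)) <= rho i * c i.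
  by rewrite /G /E; case: cid => ? [].
have sum2 := Lfun2_sum rho G2.
(* Completing the square in [h]: the best conceivable gauge for [W] is the weighted mean of the
   [G i]. *)
have dist0 : 0 <= Rintegral Q setT (fun z => (\sum_i rho i * G i z - h z) ^+ 2).
  by apply: Rintegral_ge0 => z _; exact: sqr_ge0.
rewrite (Rintegral_sqrB sum2 h2) in dist0.
have sqr_le : Rintegral Q setT (fun z => (\sum_i rho i * G i z) ^+ 2) <=
    \sum_k mean_spectrum k ^+ 2.
  rewrite [leLHS](Rintegral_mul_suml rho rho G2 G2) sum_sqr_mean_spectrum.
  apply: ler_sum => i _; apply: ler_sum => j _; rewrite ler_wpM2l ?mulr_ge0//.
  by apply: (cross_covariance_le (d_le i) (d_le j) (spectrum_gt0 i) _
    (spectrum_gt0 j) _ (Edom i) (Edom j)) => k l; exact: D_sorted.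
have cross : Rintegral Q setT (fun z => (\sum_i rho i * G i z) * h z) =
    \sum_i rho i * Rintegral Q setT (fun z => G i z * h z).
  have Ghi i := Lfun2_integrableM (G2 i) h2.
  rewrite -(Rintegral_suml rho Ghi).2; apply: eq_Rintegral => z _.
  by rewrite mulr_suml; apply: eq_bigr => i _; rewrite mulrA.
apply: (@le_trans _ _ (\sum_i rho i * (spectra_product i i
      - 2 * Rintegral Q setT (fun z => G i z * h z)
      + Rintegral Q setT (fun z => h z ^+ 2)))); last exact: ler_sum.
rewrite barycenter_valueE.
set hh := Rintegral Q setT (fun z => h z ^+ 2) in dist0 *.
have -> : \sum_i rho i * (spectra_product i i
      - 2 * Rintegral Q setT (fun z => G i z * h z) + hh) =
    \sum_i rho i * spectra_product i i
      - 2 * (\sum_i rho i * Rintegral Q setT (fun z => G i z * h z)) + hh.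
  rewrite -[X in _ = _ + X]mul1r -rho_sum mulr_sumr mulr_suml -sumrB -big_split.
  by apply: eq_bigr => i _ /=; ring.
by rewrite -cross; lra.
Qed.

Lemma GW_mean_barycenter (upsilon : probability (borel 'cV[R]_(d ord0)) R) :
  is_gaussian mean_covariance upsilon ->
  GW_barycenter rho X (euclid_gm upsilon).
Proof.
move=> gu; split=> [|W Wgm]; first exact: gaussian_gm_space gu.
apply: (@le_trans _ _ barycenter_value%:E).
  rewrite /barycenter_value -sumEFin; apply: lee_sum => i _.
  by rewrite EFinM lee_wpmul2l ?lee_fin//; exact: GW_mean_le.
have GW2_ge0 i : (0 <= (rho i)%:E * GW (X i) W ^+ 2)%E.
  by rewrite mule_ge0 ?lee_fin// expe_ge0// GW_ge0.
(* An infinite distance with positive weight makes the right-hand side infinite; at zero weight the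
   term is zero even if the distance is infinite. *)
have [[i [ri GWi]]|fin] := pselect (exists i, rho i != 0 /\ GW (X i) W = +oo%E).
  rewrite /barycenter_functional (bigD1 i)// GWi expe2 mulyy gt0_muley; last first.
    by rewrite lte_fin lt_neqAle eq_sym ri rho_ge0.
  rewrite /= addye ?leey// -ltNye.
  by apply: (@lt_le_trans _ _ 0%E); rewrite ?ltNyr// sume_ge0.
pose g i := fine (GW (X i) W).
have g0 i : 0 <= g i by rewrite fine_ge0// GW_ge0.
have GW_fin i : rho i != 0 -> GW (X i) W \is a fin_num.
  move=> ri; rewrite ge0_fin_numE ?GW_ge0// ltey.
  by apply/eqP => GWy; apply: fin; exists i.
have -> : barycenter_functional rho X W = (\sum_i rho i * g i ^+ 2)%:E.
  rewrite -sumEFin; apply: eq_bigr => i _.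
  have [->|ri] := eqVneq (rho i) 0; first by rewrite mul0e mul0r.
  by rewrite EFinM EFin_expe fineK// GW_fin.
have approx e : 0 < e -> barycenter_value <= \sum_i rho i * (g i + e) ^+ 2.
  move=> e0; apply: (barycenter_value_le Wgm) => i.
  have [->|ri] := eqVneq (rho i) 0; first by left.
  by right; exact: (GW_sqr_approx (GW_fin i ri) e0).
pose K := \sum_i rho i * g i.
have K0 : 0 <= K by apply: sumr_ge0 => i _; rewrite mulr_ge0.
have expand e : \sum_i rho i * (g i + e) ^+ 2 =
    \sum_i rho i * g i ^+ 2 + (2 * K + e) * e.
  rewrite (_ : (2 * K + e) * e = 2 * e * K + (\sum_i rho i) * e ^+ 2); last first.
    by rewrite rho_sum; ring.
  rewrite /K mulr_sumr mulr_suml -!big_split.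
  by apply: eq_bigr => i _ /=; ring.
rewrite lee_fin; apply/ler_addgt0Pr => delta delta0.
(* The excess [(2 * K + e) * e] is at most [(2 * K + 1) * e] once [e <= 1], hence at most
   [delta]. *)
pose e := Num.min 1 (delta / (2 * K + 1)).
have K1 : 0 < 2 * K + 1 by lra.
have e0 : 0 < e by rewrite lt_min ltr01 divr_gt0.
have e1 : e <= 1 by rewrite ge_min lexx.
apply: le_trans (approx e e0) _; rewrite expand lerD2l.
apply: (@le_trans _ _ ((2 * K + 1) * e)); first by apply: ler_wpM2r; [exact: ltW|rewrite lerD2l].
by rewrite mulrC -ler_pdivlMr// ge_min lexx orbT.
Qed.

Definition multi_transport : borel 'cV[R]_(d ord0) -> borel (multi_carrier X) :=
  fun x i => transport i *m (x : 'cV[R]_(d ord0)).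

Lemma measurable_multi_transport : measurable_fun setT multi_transport.
Proof.
apply: continuous_borel_measurable; apply: continuous_prod_topology => i.
exact: continuous_mulmx.
Qed.

Lemma multi_coupling_image pi i : multi_coupling X pi ->
  is_image pi (fun x : borel (multi_carrier X) => (x i : borel 'cV[R]_(d i))) (xi i).
Proof.
move=> cpi; split; last by move=> A mA; exact: (esym (cpi i A mA)).
apply: (continuous_borel_measurable (T := multi_carrier X) (U := 'cV[R]_(d i))).
exact: (@proj_continuous _ (fun j => gm_carrier (X j)) i).
Qed.

Lemma multi_GW_costE pi : multi_coupling X pi ->
  let G i := pullback_gauge (fun i (x : borel (multi_carrier X)) => x i) i in
  multi_GW_cost rho X pi =
  (2^-1 * \sum_i \sum_j rho i * rho j * (spectra_product i i
     - 2 * Rintegral (pi \x pi)%E setT (fun z => G i z * G j z)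
     + spectra_product j j))%:E.
Proof.
move=> cpi G; have im i := multi_coupling_image i cpi.
have G2 i : G i \in Lfun (pi \x pi)%E 2%:E := pullback_gauge_Lfun2 im i.
have Gij i j := Lfun2_integrable_sqr (Lfun2B (G2 i) (G2 j)).
have sum_j i := Rintegral_suml (fun j => rho i * rho j) (Gij i).
have sum_ij := Rintegral_suml (fun=> 1) (fun i => (sum_j i).1).
(* A one-term sum carries the factor 1/2 through the same linearity lemma. *)
have sum_int := Rintegral_suml (fun=> 2^-1) (fun _ : 'I_1 => sum_ij.1).
transitivity (Rintegral (pi \x pi)%E setT (fun z => \sum_(l < 1) 2^-1 *
    \sum_i 1 * \sum_j rho i * rho j * (G i z - G j z) ^+ 2))%:E.
  rewrite /Rintegral fineK; last exact: (integrable_fin_num measurableT sum_int.1).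
  apply: eq_integral => z _; rewrite big_ord1; congr (_ * _)%:E.
  apply: eq_bigr => i _; rewrite mul1r; apply: eq_bigr => j _.
  by rewrite real_normK ?num_real.
rewrite sum_int.2 big_ord1 sum_ij.2; congr (_ * _)%:E.
apply: eq_bigr => i _; rewrite mul1r (sum_j i).2; apply: eq_bigr => j _.
rewrite (Rintegral_sqrB (G2 i) (G2 j)).
by rewrite !(Rintegral_pullback_gauge_sqr im).
Qed.

Lemma multi_transport_optimal :
  exists2 pi : probability (borel (multi_carrier X)) R,
    (pi : set _ -> \bar R) = pushforward xi0 multi_transport &
    multi_optimal rho X pi.
Proof.
have [pi piE] := image_probability xi0 measurable_multi_transport.
exists pi => //.
have cpi : multi_coupling X pi.
  move=> i A mA; rewrite piE /pushforward; have [_ imT] := transport_image i.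
  exact: (esym (imT A mA)).
split=> // pi' cpi'; rewrite !multi_GW_costE// lee_fin ler_wpM2l//.
have imq : is_image xi0 multi_transport pi.
  split; first exact: measurable_multi_transport.
  by move=> A mA; exact: (congr1 (fun m => m A) piE).
have im i := multi_coupling_image i cpi.
have im' i := multi_coupling_image i cpi'.
apply: ler_sum => i _; apply: ler_sum => j _; rewrite ler_wpM2l ?mulr_ge0//.
(* The square terms cancel. The cross terms of [pi'] are at most [spectra_product i j], the value
   attained by [pi]. *)
rewrite lerD2r lerD2l lerN2 ler_wpM2l//.
apply: le_trans (Rintegral_pullback_gauge_le im' i j) _.
rewrite (Rintegral_image (is_image_prod imq)); last first.
  by apply: measurable_funM;
    [exact: (Lfun2_measurable (pullback_gauge_Lfun2 im i))|
     exact: (Lfun2_measurable (pullback_gauge_Lfun2 im j))].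
rewrite le_eqVlt; apply/orP; left; apply/eqP.
rewrite -[LHS](Rintegral_std_gauge (pspectrum i) (pspectrum j)).
by apply: eq_Rintegral => z _; congr (_ * _); exact/esym/dotv_transport.
Qed.

End gaussian_family.

(** The barycenter law is specified by its one-dimensional projections; the separate existence
    clause keeps the final quantification over such laws from being vacuous. *)
Theorem theorem5p2 (R : realType) (N : nat)
    (d : 'I_N.+1 -> nat)
    (d_gt0 : forall i, (0 < d i)%N)
    (d_le : forall i j : 'I_N.+1, (i <= j)%N -> (d j <= d i)%N)
    (Sigma P D : forall i, 'M[R]_(d i))
    (xi : forall i, probability (borel 'cV[R]_(d i)) R)
    (xi_gaussian : forall i, is_gaussian (Sigma i) (xi i))
    (Sigma_nondegenerate : forall i, Sigma i \in unitmx)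
    (P_orthogonal : forall i, orthogonal_mx (P i))
    (D_diag : forall i, is_diag_mx (D i))
    (D_sorted : forall i (k l : 'I_(d i)), (k <= l)%N -> D i l l <= D i k k)
    (SigmaE : forall i, Sigma i = P i *m D i *m (P i)^T)
    (J : forall i, 'M[R]_(d i))
    (J_sign : forall i, sign_diag (J i))
    (rho : 'I_N.+1 -> R)
    (rho_simplex : simplex rho) :
  let d1_ge i : (d i <= d ord0)%N := d_le ord0 i (leq0n i) in
  let X i := euclid_gm (xi i) in
  let A i := transport_mx (d1_ge i) (J i) (D i) (D ord0) in
  let T : borel 'cV[R]_(d ord0) -> borel (multi_carrier X) :=
    fun x i => P i *m A i *m (P ord0)^T *m x in
  let S := \sum_(i < N.+1) rho i *: pad_square (d1_ge i) (D i) in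
  [/\ forall i, gm_space (X i),
      exists2 pi : probability (borel (multi_carrier X)) R,
        (pi : set _ -> \bar R) = pushforward (xi ord0) T &
        multi_optimal rho X pi,
      exists upsilon : probability (borel 'cV[R]_(d ord0)) R,
        is_gaussian S upsilon &
      forall upsilon : probability (borel 'cV[R]_(d ord0)) R,
        is_gaussian S upsilon -> GW_barycenter rho X (euclid_gm upsilon)].
Proof.
move=> d1_ge X A T S; have [rho01 rho_sum] := rho_simplex.
have rho_ge0 i : 0 <= rho i by case/andP: (rho01 i).
pose s i := projT1 (cid2 (J_sign i)).
have s_sign i k : s i 0 k = -1 \/ s i 0 k = 1 by rewrite /s; case: cid2 => ? ? ?.
have JE i : J i = diag_mx (s i) by rewrite /s; case: cid2 => ? ? ?.
split.
- by move=> i; exact: gaussian_gm_space (xi_gaussian i).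
- exact: (multi_transport_optimal d1_ge xi_gaussian Sigma_nondegenerate
    P_orthogonal D_diag D_sorted SigmaE JE s_sign rho_ge0).
- exact: (mean_gaussian_exists d1_ge xi_gaussian Sigma_nondegenerate
    P_orthogonal D_diag SigmaE rho_ge0).
- move=> upsilon; exact: (GW_mean_barycenter xi_gaussian
    Sigma_nondegenerate P_orthogonal D_diag D_sorted SigmaE JE s_sign rho_ge0 rho_sum).
Qed.
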